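(* \[ K(\mathcal{A}_2) = K_2 \geq 0.3006 . \]
   Context: $\mathbb{D}^d=\{z=(z_1,\dots,z_d)\in\mathbb{C}^d: |z_1|,\dots,|z_d|<1\}$ is the open unit polydisk. The Schur class $\mathcal{S}_d$ is the set of all analytic $f:\mathbb{D}^d\to\overline{\mathbb{D}}$, where $\overline{\mathbb D}$ is the closed unit disk. The (Schur-)Agler class $\mathcal{A}_d$ is the set of all $f\in\mathcal{S}_d$ such that $\|f(T_1,\dots,T_d)\|\leq 1$ (operator norm) for all $d$-tuples $T=(T_1,\dots,T_d)$ of pairwise commuting strictly contractive operators ($\|T_j\|<1$) on a common complex Hilbert space; here, if $f(z)=\sum_{\alpha\in\mathbb{N}^d} f_\alpha z^\alpha$, then $f(T)=\sum_\alpha f_\alpha T^\alpha$, with $T^\alpha=T_1^{\alpha_1}\cdots T_d^{\alpha_d}$ and $\mathbb{N}$ including $0$. For $f(z)=\sum_\alpha f_\alpha z^\alpha$ set $\|f\|_1=\sum_\alpha|f_\alpha|$, and for $0<r<1$ set $f_r(z)=f(rz)$. The Bohr radius is $K_d=\sup\{r\in(0,1): \|f_r\|_1\leq 1 \text{ for all } f\in\mathcal{S}_d\}$ and the Bohr-Agler radius is $K(\mathcal{A}_d)=\sup\{r\in(0,1): \|f_r\|_1\leq 1 \text{ for all } f\in\mathcal{A}_d\}$. *)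

(* Defs.v *)
From HB Require Import structures.
From mathcomp Require Import all_boot all_order all_algebra.
From mathcomp Require Import finmap sesquilinear complex.
From mathcomp Require Import all_classical all_reals all_analysis.
From mathcomp.analysis.showcase Require Import summability.

Set Implicit Arguments.
Unset Strict Implicit.
Unset Printing Implicit Defensive.

Import Order.TTheory GRing.Theory Num.Theory.
Import numFieldNormedType.Exports.

Local Open Scope classical_set_scope.
Local Open Scope ring_scope.

(* The library puts a topology and a norm on R[i]^o only; R[i] inherits them. *)
HB.instance Definition _ (R : realType) := NormedModule.copy R[i] R[i]^o.

(* Norms of normed spaces over R[i] are values in R[i] (with zero imaginary
   part); rnorm is the same norm, as an element of R. *)
Definition rnorm (R : realType) (V : normedZmodType R[i]) (x : V) : R :=
  complex.Re `|x|.

Definition multi_index (d : nat) := {ffun 'I_d -> nat}.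

Definition mdegree (d : nat) (a : multi_index d) : nat := (\sum_(i < d) a i)%N.

Section PowerSeries.
Variables (R : realType) (d : nat).

Definition polydisk : set 'rV[R[i]]_d := [set z | forall i, `|z 0 i| < 1].

Definition monomial (z : 'rV[R[i]]_d) (a : multi_index d) : R[i] :=
  \prod_(i < d) z 0 i ^+ a i.

(* f(z) = \sum_a c_a z^a for all z in the open polydisk, as an unordered sum,
   i.e., the limit of the net of finite partial sums. *)
Definition expansion (f : 'rV[R[i]]_d -> R[i]) (c : multi_index d -> R[i]) :=
  forall z, polydisk z ->
    partial_sum (fun a => c a * monomial z a) @ totally --> f z.

Definition norm1 (c : multi_index d -> R[i]) : \bar R :=
  \esum_(a in setT) (rnorm (c a))%:E.

(* Coefficients of z |-> f(rz) in terms of those of f, see expansion_dilate. *)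
Definition dilate (r : R) (c : multi_index d -> R[i]) : multi_index d -> R[i] :=
  fun a => c a * r%:C%C ^+ mdegree a.

Lemma expansion_dilate (f : 'rV[R[i]]_d -> R[i]) (c : multi_index d -> R[i])
    (r : R) :
  0 < r < 1 -> expansion f c ->
  expansion (fun z => f (r%:C%C *: z)) (dilate r c).
Proof.
move=> /andP[r0 r1] fc z Dz.
have Dw : polydisk (r%:C%C *: z).
  move=> i; rewrite mxE normrM normc_def /= expr0n addr0 sqrtr_sqr gtr0_norm //.
  rewrite -[ltRHS]mulr1; apply: ltr_pM => //; first by rewrite lecR ltW.
  by rewrite ltcR.
have -> : (fun a => dilate r c a * monomial z a) =
          (fun a => c a * monomial (r%:C%C *: z) a).
  apply/funext => a; rewrite /dilate -mulrA; congr (_ * _).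
  rewrite /monomial /mdegree -prodrXr -big_split /=; apply: eq_bigr => i _.
  by rewrite mxE exprMn.
exact: fc.
Qed.

(* A function on the polydisk is represented by a total function, only whose
   values on the polydisk matter. Differentiability is over the field R[i],
   i.e., it is complex (Frechet) differentiability. *)
Definition schur_class : set ('rV[R[i]]_d -> R[i]) :=
  [set f | forall z, polydisk z ->
     differentiable f z /\ `|f z| <= 1].

End PowerSeries.

Section Operators.
Variables (R : realType) (H : normedModType R[i]).

(* Possibly +oo; it is finite exactly when the linear map F is bounded. *)
Definition opnorm (F : H -> H) : \bar R :=
  ereal_sup [set (rnorm (F h))%:E | h in [set h | `|h| <= 1]].

Definition op_monomial (d : nat) (T : 'I_d -> {linear H -> H})
    (a : multi_index d) : H -> H :=
  \big[(fun F G : H -> H => F \o G)/idfun]_(i < d) iter (a i) (T i).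

(* F = \sum_a c_a T^a, in operator norm. *)
Definition op_expansion (d : nat) (c : multi_index d -> R[i])
    (T : 'I_d -> {linear H -> H}) (F : {linear H -> H}) :=
  (fun A => opnorm (fun h =>
     F h - partial_sum (fun a => c a *: op_monomial T a h) A)) @ totally
  --> 0%E.

End Operators.

Definition hilbert_norm (R : realType) (H : completeNormedModType R[i])
    (dot : {dot H for Num.conj}) :=
  forall h : H, `|h| ^+ 2 = dot h h.

Definition agler_class (R : realType) (d : nat) :
    set ('rV[R[i]]_d -> R[i]) :=
  [set f | schur_class f /\ exists2 c, expansion f c &
    forall (H : completeNormedModType R[i]) (dot : {dot H for Num.conj}),
      hilbert_norm dot ->
    forall T : 'I_d -> {linear H -> H},
      (forall i j h, T i (T j h) = T j (T i h)) ->
      (forall i, (opnorm (T i) < 1)%E) ->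
    exists2 F : {linear H -> H}, op_expansion c T F & (opnorm F <= 1)%E].

(* The power series expansion of a holomorphic function on the polydisk exists
   and is unique, so that quantifying over all expansions of f amounts to
   considering the one expansion of f. *)
Definition class_bohr_radius (R : realType) (d : nat)
    (S : set ('rV[R[i]]_d -> R[i])) : R :=
  sup [set r | 0 < r < 1 /\
    forall f, S f -> forall c, expansion f c -> (norm1 (dilate r c) <= 1)%E].

Definition bohr_radius (R : realType) (d : nat) : R :=
  class_bohr_radius (@schur_class R d).

Definition bohr_agler_radius (R : realType) (d : nat) : R :=
  class_bohr_radius (@agler_class R d).

(* Main.v *)
Require Import Defs.
From HB Require Import structures.
From mathcomp Require Import all_boot all_order all_algebra perm.
From mathcomp Require Import finmap sesquilinear spectral complex.
From mathcomp Require Import all_classical all_reals all_analysis.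
From mathcomp.analysis.showcase Require Import summability.
From mathcomp Require Import ring lra.

(** Both radii are suprema of sets of numbers r, and the two sets are equal: a
    bounded function f on the bidisk with a power series is in the Agler class
    [schur_agler2], which is Ando's theorem. The bound 0.3006 comes from an
    inequality for the coefficients of each degree [folded_norm_sum].

    Ando's theorem is reached without dilations to infinite-dimensional spaces.
    Commuting unitary matrices satisfy von Neumann's inequality because they
    are jointly diagonalisable [commuting_unitary_von_neumann]. A commuting
    pair S1, S2 of nilpotent matrices which is contractive for a seminorm M is
    a compression of such a pair: with M - S_j M S_j^* = D_j D_j^*, the two
    expressions of the defect of S1 S2 give matrices with the same Gram matrix,
    hence a unitary U between them [equal_gram_unitary]; sending x to the
    sequence of the defects of x (S1 S2)^k is an isometry into a space of
    cyclic sequences, on which U and the cyclic shift define two commuting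
    isometries that act like S1 and S2 on all but the last few terms
    [finite_ando]. Commuting contractions T1, T2 of a Hilbert space are reduced
    to that case: given h, the shifts of the arrays (x_ij) with i, j < Q are
    nilpotent and contractive for the sum over s, t of the squared norms of the
    vectors sum_(i <= s, j <= t) x_ij T1^i T2^j h. For a polynomial p of small
    degree, most of these vectors built from the array of p equal p(T) h, and
    letting Q tend to infinity gives |p(T) h| <= sup |p| |h| [hilbert_ando].
    The boxes of coefficients of f(t z), with t < 1, are polynomials with
    supremum at most 1 + e on the torus, and a power series in strict
    contractions is absolutely convergent, so f inherits the inequality
    [agler_sum].

    For the lower bound, write a = |f_00|. For every n >= 1 the sum of the
    |f_kl| with k + l = n is at most sqrt n (1 - a^2). There are n + 1 such
    coefficients, but the ones at z^n and w^n may be added: after a rotation of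
    z, apply von Neumann's inequality to Z1 = C (x) Z and Z2 = 1 (x) Z with C a
    cyclic shift of size n and Z a long cyclic shift. On a suitable vector it
    says that S = (|f_n0| + |f_0n|)^2 + sum_(0 < k < n) |f_k(n-k)|^2 satisfies
    S <= (1 - a^2)^2 [folded_energy, folded_norm_sum], and Cauchy-Schwarz with
    n terms ends the argument. Since the sum of sqrt n r^n over n >= 1 is at most 1/2 for
    r = 0.3006 [sqrt_series_bound], the sum of all |f_kl| r^(k + l) is at most
    a + (1 - a^2) / 2 <= 1. *)

Set Implicit Arguments.
Unset Strict Implicit.
Unset Printing Implicit Defensive.

Import Order.TTheory GRing.Theory Num.Theory.
Import numFieldNormedType.Exports.

Local Open Scope classical_set_scope.
Local Open Scope ring_scope.

#[local] Existing Instance totally_filter.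

(** * Polynomials in two operators *)

Section OperatorPolynomials.
Variables (K : comNzRingType) (N : nat).
Implicit Types (P : 'M[K]_N).

(** The value of the polynomial with coefficients P i j at the pair (f, g), with
    plain functions so that it applies alike to matrices, operators and shifts. *)
Definition opoly (V : lmodType K) P (f g : V -> V) (x : V) : V :=
  \sum_(i < N) \sum_(j < N) P i j *: iter i f (iter j g x).

Definition poly2 P (a b : K) : K :=
  \sum_(i < N) \sum_(j < N) P i j * (a ^+ i * b ^+ j).

Lemma iter_semiconj (T T' : Type) (h : T -> T') (f : T -> T) (f' : T' -> T') n x :
  (forall x, h (f x) = f' (h x)) -> h (iter n f x) = iter n f' (h x).
Proof. by move=> hf; elim: n => //= n <-. Qed.

Lemma opoly_semiconj (V W : lmodType K) (h : {linear V -> W}) P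
    (f g : V -> V) (f' g' : W -> W) x :
  (forall x, h (f x) = f' (h x)) -> (forall x, h (g x) = g' (h x)) ->
  h (opoly P f g x) = opoly P f' g' (h x).
Proof.
move=> hf hg; rewrite linear_sum; apply: eq_bigr => i _.
rewrite linear_sum; apply: eq_bigr => j _.
by rewrite linearZ /= (iter_semiconj _ _ hf) (iter_semiconj _ _ hg).
Qed.

Lemma opoly_linear (V : lmodType K) P (f g : {linear V -> V}) :
  linear (opoly P f g).
Proof.
have it (h : {linear V -> V}) n : linear (iter n h).
  by move=> k x y; elim: n => //= n ->; rewrite linearP.
move=> a x y; rewrite scaler_sumr -big_split /=; apply: eq_bigr => i _.
rewrite scaler_sumr -big_split /=; apply: eq_bigr => j _.
by rewrite !it scalerDr !scalerA mulrC.
Qed.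

HB.instance Definition _ (V : lmodType K) P (f g : {linear V -> V}) :=
  GRing.isLinear.Build K V V _ (opoly P f g) (opoly_linear P f g).

End OperatorPolynomials.

Section Frobenius.
Local Open Scope sesquilinear_scope.
Variable C : numClosedFieldType.

Definition frob m n (X : 'M[C]_(m, n)) : C := \tr (X *m X^t*).

Lemma frobE m n (X : 'M[C]_(m, n)) : frob X = \sum_i \sum_j `|X i j| ^+ 2.
Proof.
apply: eq_bigr => i _; rewrite mxE; apply: eq_bigr => j _.
by rewrite !mxE -normCK.
Qed.

Lemma frob_ge0 m n (X : 'M[C]_(m, n)) : 0 <= frob X.
Proof. by rewrite frobE; do 2!apply: sumr_ge0 => ? _; rewrite exprn_ge0. Qed.

Lemma frob_mulr m n p (X : 'M[C]_(m, n)) (U : 'M[C]_(n, p)) :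
  U \is unitarymx -> frob (X *m U) = frob X.
Proof.
move=> /unitarymxP UU.
by rewrite /frob trmx_mul map_mxM mulmxA -(mulmxA X) UU mulmx1.
Qed.

Lemma trmxC_mul m n p (A : 'M[C]_(m, n)) (B : 'M[C]_(n, p)) :
  (A *m B)^t* = B^t* *m A^t*.
Proof. by rewrite trmx_mul map_mxM. Qed.

Lemma unitary_trig_diag n (A : 'M[C]_n) : A \is unitarymx ->
  is_trig_mx A -> is_trig_mx (A^t*) -> exists2 a : 'rV_n, A = diag_mx a &
    forall i, `|a 0 i| = 1.
Proof.
move=> /unitarymxP AA /is_trig_mxP tA /is_trig_mxP tA'.
have dA : A = diag_mx (\row_i A i i).
  apply/matrixP=> i j; rewrite !mxE; case: (ssrnat.ltngtP i j) => [ij|ji|/ord_inj ->].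
  - by rewrite tA // -val_eqE (ltn_eqF ij).
  - rewrite -val_eqE eq_sym (ltn_eqF ji).
    by move: (tA' _ _ ji) => /eqP; rewrite !mxE conjC_eq0 => /eqP.
  - by rewrite eqxx.
exists (\row_i A i i) => // i; rewrite mxE.
have /matrixP/(_ i i) := AA; rewrite dA tr_diag_mx map_diag_mx mulmx_diag !mxE eqxx !mulr1n.
rewrite -normCK => /eqP; rewrite sqrf_eq1 => /orP[/eqP //|/eqP h].
by have := normr_ge0 (A i i); rewrite h ler0N1.
Qed.

(** Commuting unitary matrices are simultaneously diagonalised by a unitary
    matrix, and their joint eigenvalues lie on the torus. *)
Lemma commuting_unitary_von_neumann N m (P : 'M[C]_N) (beta : C)
    (A B : 'M[C]_m) (x : 'rV_m) :
  A \is unitarymx -> B \is unitarymx -> A *m B = B *m A ->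
  (forall a b : C, `|a| = 1 -> `|b| = 1 -> `|poly2 P a b| <= beta) ->
  frob (opoly P (mulmxr A) (mulmxr B) x) <= beta ^+ 2 * frob x.
Proof.
move=> uA uB AB bP.
(* A unitary triangular matrix is diagonal: its adjoint is triangular as well,
   when the adjoints are made triangular together with A and B. *)
have [] := @cotrigonalization C m [:: A; A^t*; B; B^t*].
  have cU (U : 'M[C]_m) : U \is unitarymx -> U *m U^t* = U^t* *m U.
    by move=> /unitarymxP uU; rewrite uU (mulmx1C uU).
  have cV (U V : 'M[C]_m) : V \is unitarymx -> U *m V = V *m U -> U *m V^t* = V^t* *m U.
    move=> uV /(congr1 (fun W => V^t* *m W *m V^t*)); rewrite !mulmxA mulmxtVK //.
    by rewrite (mulmx1C (unitarymxP uV)) mul1mx.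
  have ss (U V : 'M[C]_m) : U *m V = V *m U -> U^t* *m V^t* = V^t* *m U^t*.
    by move=> h; rewrite -!trmxC_mul h.
  have AB' := cV _ _ uB AB; have BA' := cV _ _ uA (esym AB).
  have A'B' := ss _ _ AB.
  move=> U V; rewrite !inE => /or4P[]/eqP-> /or4P[]/eqP-> //; rewrite /comm_mx ?cU //.
move=> S uS /= /and5P[tA tA' tB tB' _].
have conjS (U : 'M[C]_m) : similar_trig S U -> similar_trig S (U^t*) -> U \is unitarymx ->
    exists2 a : 'rV_m, S *m U *m S^t* = diag_mx a & forall i, `|a 0 i| = 1.
  move=> tU tU' uU; apply: unitary_trig_diag.
  - by rewrite !mul_unitarymx ?trmxC_unitary.
  - by move: tU; rewrite /similar_to conjymx.
  - by move: tU'; rewrite /similar_to conjymx // !trmxC_mul trmxCK mulmxA.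
have [a Sa a1] := conjS _ tA tA' uA; have [b Sb b1] := conjS _ tB tB' uB.
rewrite -(@frob_mulr _ _ _ _ (S^t*)) ?trmxC_unitary //.
rewrite -[X in _ * X](@frob_mulr _ _ _ _ (S^t*)) ?trmxC_unitary //.
have sc (U : 'M[C]_m) (c : 'rV_m) : S *m U *m S^t* = diag_mx c ->
    forall y : 'rV_m, mulmxr (S^t*) (mulmxr U y) = mulmxr (diag_mx c) (mulmxr (S^t*) y).
  by move=> <- y; rewrite /= !mulmxA mulmxKtV.
rewrite -[X in frob X <= _]/(mulmxr (S^t*) _) -[X in _ * frob X]/(mulmxr (S^t*) x).
rewrite (opoly_semiconj _ _ (sc _ _ Sa) (sc _ _ Sb)) /=.
move: (x *m _) => y.
rewrite !frobE !big_ord1 mulr_sumr; apply: ler_sum => k _.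
have -> : opoly P (mulmxr (diag_mx a)) (mulmxr (diag_mx b)) y ord0 k =
    poly2 P (a 0 k) (b 0 k) * y ord0 k.
  have it (c z : 'rV[C]_m) n :
      iter n (mulmxr (diag_mx c)) z ord0 k = c 0 k ^+ n * z ord0 k.
    elim: n => [|n IH]; first by rewrite mul1r.
    by rewrite iterS /= mul_mx_diag mxE IH exprS mulrC mulrA.
  rewrite summxE mulr_suml; apply: eq_bigr => i _; rewrite summxE mulr_suml.
  by apply: eq_bigr => j _; rewrite mxE !it !mulrA.
rewrite normrM exprMn ler_wpM2r ?exprn_ge0 //.
by rewrite lerXn2r ?nnegrE ?bP // (le_trans _ (bP _ _ (a1 k) (b1 k))).
Qed.

(** In the coordinates [mxvec] a linear isometry of matrices, for the Frobenius
    inner product, is a unitary matrix. *)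
Lemma commuting_isometry_von_neumann N m n (P : 'M[C]_N) (beta : C)
    (f g : {linear 'M[C]_(m, n) -> 'M[C]_(m, n)}) X :
  (forall X Y, \tr (f X *m (f Y)^t*) = \tr (X *m Y^t*)) ->
  (forall X Y, \tr (g X *m (g Y)^t*) = \tr (X *m Y^t*)) ->
  (forall X, f (g X) = g (f X)) ->
  (forall a b : C, `|a| = 1 -> `|b| = 1 -> `|poly2 P a b| <= beta) ->
  frob (opoly P f g X) <= beta ^+ 2 * frob X.
Proof.
move=> isof isog fg bP.
have dot (Y Z : 'M[C]_(m, n)) : (mxvec Y *m (mxvec Z)^t*) 0 0 = \tr (Y *m Z^t*).
  rewrite mxE /mxtrace; under [RHS]eq_bigr do rewrite mxE.
  rewrite pair_bigA (reindex _ (curry_mxvec_bij _ _)) /=; apply: eq_bigr => -[i j] _ /=.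
  by rewrite !mxE !mxvecE.
have uni (h : {linear 'M[C]_(m, n) -> 'M[C]_(m, n)}) :
    (forall X Y, \tr (h X *m (h Y)^t*) = \tr (X *m Y^t*)) -> lin_mx h \is unitarymx.
  move=> isoh; apply/row_unitarymxP => i j; rewrite dotmxE !rowE !mul_rV_lin dot isoh -dot.
  rewrite !vec_mxK mxE (bigD1 j) //= !mxE !eqxx conjC1 mulr1 eq_sym big1 ?addr0 // => k kj.
  by rewrite !mxE (negbTE kj) andbF conjC0 mulr0.
have fro (Y : 'M[C]_(m, n)) : frob Y = frob (mxvec Y).
  by rewrite /frob -dot trace_mx11.
have sc (h : {linear 'M[C]_(m, n) -> 'M[C]_(m, n)}) Y :
   mxvec (h Y) = mulmxr (lin_mx h) (mxvec Y) by rewrite /= mul_vec_lin.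
rewrite !fro (opoly_semiconj _ _ (sc f) (sc g)).
apply: commuting_unitary_von_neumann => //; try exact: uni.
apply/row_matrixP => i; rewrite !row_mul !rowE -!mulmxA.
by rewrite -(vec_mxK (delta_mx 0 i)) !mulmxA !mul_vec_lin /= fg.
Qed.

End Frobenius.

(** * Factorizations of matrices *)

Section Factorizations.
Local Open Scope sesquilinear_scope.
Variable C : numClosedFieldType.

Lemma row_mul_trmxC k l n (A : 'M[C]_(k, n)) (B : 'M[C]_(l, n)) i j :
  (row i A *m (row j B)^t*) 0 0 = (A *m B^t*) i j.
Proof. by rewrite !mxE; apply: eq_bigr => h _; rewrite !mxE. Qed.

Lemma trmxC_scale m n c (A : 'M[C]_(m, n)) : (c *: A)^t* = c^* *: A^t*.
Proof. by apply/matrixP => i j; rewrite !mxE rmorphM. Qed.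

Lemma psd_factorization n (M : 'M[C]_n) :
  M^t* = M -> (forall x : 'rV_n, 0 <= (x *m M *m x^t*) 0 0) ->
  exists D : 'M[C]_n, M = D *m D^t*.
Proof.
move=> hM pM; have /orthomx_spectralP : M \is normalmx by apply/normalmxP; rewrite hM.
have uP := spectral_unitarymx M; rewrite invmx_unitary //.
move: (spectralmx M) (spectral_diag M) uP => P d uP eM.
have d0 i : 0 <= d 0 i.
  have := pM (row i P); rewrite -row_mul row_mul_trmxC eM !mulmxA (unitarymxP uP) mul1mx.
  by rewrite mulmxtVK // mxE eqxx mulr1n.
exists (P^t* *m diag_mx (\row_i sqrtC (d 0 i))).
rewrite trmxC_mul trmxCK tr_diag_mx map_diag_mx !mulmxA -(mulmxA (P^t*)) mulmx_diag {1}eM.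
congr (_ *m diag_mx _ *m _); apply/rowP => i; rewrite !mxE -normCK.
by rewrite ger0_norm ?sqrtC_ge0 // sqrtCK.
Qed.

(** The matrix H is the complex reflection 1 - c^-1 w^* w along w = a - b. It is
    unitary when c + c^* = w w^*, and the value c = a w^* that sends a to b has
    this property because a and b have the same norm. *)
Lemma householder m (a b : 'rV[C]_m) : a *m a^t* = b *m b^t* ->
  exists H : 'M[C]_m, [/\ H \is unitarymx, a *m H = b &
    forall v : 'rV_m, v *m (a - b)^t* = 0 -> v *m H = v].
Proof.
move=> aa; move e : (a - b) => w.
have [w0|w0] := eqVneq w 0.
  exists 1%:M; split=> [||v _]; rewrite ?mulmx1 //.
    by apply/unitarymxP; rewrite trmx1 map_mx1 mulmx1.
  by apply/eqP; rewrite -subr_eq0 e w0.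
move c_def : ((a *m w^t*) 0 0) => c.
have wE : w^t* = a^t* - b^t* by rewrite -e linearB /= map_mxB.
have cJ : c^* = (w *m a^t*) 0 0.
  rewrite -c_def !mxE rmorph_sum; apply: eq_bigr => i _.
  by rewrite rmorphM !mxE /= conjCK mulrC.
have cc : c + c^* = (w *m w^t*) 0 0.
  rewrite cJ -c_def wE -e !(mulmxBl, mulmxBr) aa !mxE.
  by rewrite opprB addrC.
have c0 : c != 0.
  apply: contra_neq w0 => c0; move: cc; rewrite c0 conjC0 addr0 => /esym/eqP.
  by rewrite -dotmxE dnorm_eq0 => /eqP.
exists (1%:M - c^-1 *: (w^t* *m w)); split=> [||v vw].
- apply/unitarymxP; rewrite linearB /= map_mxB trmx1 map_mx1 trmxC_scale.
  rewrite trmxC_mul trmxCK mulmxBl mul1mx mulmxBr mulmx1 -scalemxAl -scalemxAr mulmxA.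
  rewrite -(mulmxA _ w) (mx11_scalar (w *m w^t*)) -cc mul_mx_scalar -scalemxAl.
  rewrite !scalerA -addrA -opprD -scalerBl -scalerDl.
  rewrite [X in X *: _](_ : _ = 0) ?scale0r ?subr0 //.
  by rewrite fmorphV; field; rewrite conjC_eq0 c0.
- rewrite mulmxBr mulmx1 -scalemxAr mulmxA (mx11_scalar (a *m w^t*)) c_def.
  by rewrite mul_scalar_mx scalerA mulVf // scale1r -e opprB addrC subrK.
- by rewrite mulmxBr mulmx1 -scalemxAr mulmxA vw mul0mx scaler0 subr0.
Qed.

(** Row by row: a reflection that moves the next row of A U to the row of B fixes
    the previous rows of B, since these have equal inner products with both. *)
Lemma equal_gram_unitary k m (A B : 'M[C]_(k, m)) :
  A *m A^t* = B *m B^t* -> exists2 U : 'M[C]_m, U \is unitarymx & A *m U = B.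
Proof.
move=> AB.
have gram (i j : 'I_k) : row i A *m (row j A)^t* = row i B *m (row j B)^t*.
  by apply/matrixP => p q; rewrite !ord1 !row_mul_trmxC AB.
suff /(_ k)[U uU UP] n : exists2 U : 'M[C]_m, U \is unitarymx &
    forall i : 'I_k, (i < n)%N -> row i A *m U = row i B.
  by exists U => //; apply/row_matrixP => i; rewrite row_mul UP.
elim: n => [|n [U uU IH]].
  by exists 1%:M => //; apply/unitarymxP; rewrite trmx1 map_mx1 mulmx1.
have [kn|nk] := leqP k n.
  by exists U => // i _; apply: IH; apply: leq_trans kn.
pose o := Ordinal nk.
have [|H [uH Ho Hfix]] := @householder _ (row o A *m U) (row o B).
  by rewrite trmxC_mul mulmxA mulmxtVK.
exists (U *m H) => [|i]; first exact: mul_unitarymx.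
rewrite ltnS mulmxA leq_eqVlt => /predU1P[io|lin].
  by rewrite (_ : i = o) //; apply: val_inj.
rewrite IH // Hfix // linearB /= map_mxB mulmxBr -{1}(IH i lin) trmxC_mul.
by rewrite mulmxA mulmxtVK // gram subrr.
Qed.

End Factorizations.

(** * Commuting pairs of nilpotent matrices *)

Section CyclicShift.
Local Open Scope sesquilinear_scope.
Variable C : numClosedFieldType.

Definition cshift L : 'M[C]_L := perm_mx (perm (@ordS_inj L)).

Lemma cshift_unitary L : cshift L \is unitarymx.
Proof.
apply/unitarymxP; rewrite tr_perm_mx map_perm_mx -perm_mxM.
by rewrite mulgV perm_mx1.
Qed.

Lemma row_cshift L n (Y : 'M[C]_(L, n)) k : row k (cshift L *m Y) = row (ordS k) Y.
Proof. by rewrite -row_permE; apply/rowP => j; rewrite !mxE permE. Qed.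

End CyclicShift.

Section FiniteAndo.
Local Open Scope sesquilinear_scope.
Variables (C : numClosedFieldType) (N K n : nat) (M S1 S2 D1 D2 : 'M[C]_n).
Hypothesis S12 : S1 *m S2 = S2 *m S1.
Hypothesis D1E : M - S1 *m M *m S1^t* = D1 *m D1^t*.
Hypothesis D2E : M - S2 *m M *m S2^t* = D2 *m D2^t*.

Local Notation T := (S1 *m S2).

(** One of the two factorizations of the defect of T; the other one, with the
    roles of S1 and S2 exchanged, is row_mx (S1 *m D2) D1. *)
Local Notation Delta := (row_mx (S2 *m D1) D2).

(* The first K terms of a sequence carry the energy of a vector, and the last
   N + N terms absorb the wrap-around of the shift, which a polynomial of
   degree less than N in each variable applies less than N + N times. *)
Let L := (K + (N + N))%N.

Let energy (x : 'rV[C]_n) := (x *m M *m x^t*) 0 0.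

Let defect_gram : Delta *m Delta^t* = M - T *m M *m T^t*.
Proof.
rewrite tr_row_mx map_col_mx mul_row_col -D2E trmxC_mul mulmxA -(mulmxA S2) -D1E.
by rewrite mulmxBr mulmxBl addrC subrKA S12 trmxC_mul !mulmxA.
Qed.

Let energyE x : energy x = frob (x *m Delta) + energy (x *m T).
Proof.
rewrite /frob trace_mx11 trmxC_mul mulmxA -(mulmxA x) defect_gram /energy.
by rewrite mulmxBr mulmxBl [(x *m T)^t*]trmxC_mul !mulmxA !mxE subrK.
Qed.

Let energy_sum k x : energy x =
  \sum_(i < k) frob (iter i (mulmxr T) x *m Delta) + energy (iter k (mulmxr T) x).
Proof.
elim: k => [|k IH]; first by rewrite big_ord0 add0r.
by rewrite big_ord_recr /= IH -addrA -energyE.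
Qed.

Let E1 : 'M[C]_(n + n) := block_mx 0 0 1%:M 0.
Let E2 : 'M[C]_(n + n) := block_mx 0 1%:M 0 0.

Let E11 : E1 *m E1 = 0.
Proof. by rewrite mulmx_block !(mulmx0, mul0mx, addr0, mulmx1); apply: block_mx0. Qed.

Let E22 : E2 *m E2 = 0.
Proof. by rewrite mulmx_block !(mulmx0, mul0mx, addr0, mulmx1); apply: block_mx0. Qed.

Let E12 : E1 *m E2 + E2 *m E1 = 1%:M.
Proof.
rewrite !mulmx_block !(mulmx0, mul0mx, addr0, add0r, mulmx1) add_block_mx.
by rewrite !(addr0, add0r) -scalar_mx_block.
Qed.

Let E1C : E1^t* = E2.
Proof. by rewrite tr_block_mx map_block_mx !trmx0 trmx1 !map_mx0 map_mx1. Qed.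

Let E2C : E2^t* = E1.
Proof. by rewrite -E1C trmxCK. Qed.

(** The rows of Y are a cyclic sequence of pairs. When it is read with the second
    component of each pair before the first one, psi is the shift by one place,
    so its square shifts by one pair. *)
Let psi (Y : 'M[C]_(L, n + n)) : 'M[C]_(L, n + n) := cshift C L *m Y *m E1 + Y *m E2.

Let psi_iso X Y : \tr (psi X *m (psi Y)^t*) = \tr (X *m Y^t*).
Proof.
have mulE (P Q : 'M[C]_(L, n + n)) (R S : 'M[C]_(n + n, L)) :
    (P *m E1 + Q *m E2) *m (E2 *m R + E1 *m S) =
    P *m (E1 *m E2) *m R + Q *m (E2 *m E1) *m S.
  rewrite mulmxDl !mulmxDr !mulmxA -(mulmxA P E1 E1) -(mulmxA Q E2 E2) E11 E22.
  by rewrite !mulmx0 !mul0mx addr0 add0r.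
rewrite /psi linearD /= map_mxD !trmxC_mul E1C E2C mulE linearD /=.
rewrite mulmxA [in X in X + _]mxtrace_mulC !mulmxA.
rewrite (mulmx1C (unitarymxP (cshift_unitary C L))) mul1mx -linearD /=.
by rewrite -mulmxDl -!(mulmxA X) -mulmxDr E12 mulmx1.
Qed.

Let psi_psi Y : psi (psi Y) = cshift C L *m Y.
Proof.
rewrite /psi mulmxDr !mulmxDl.
rewrite !mulmxA -(mulmxA _ E1 E1) -(mulmxA _ E2 E2) E11 E22 !mulmx0 add0r addr0.
by rewrite -(mulmxA _ E2 E1) -(mulmxA _ E1 E2) -mulmxDr addrC E12 mulmx1.
Qed.

Section Model.
Variable U : 'M[C]_(n + n).
Hypothesis uU : U \is unitarymx.
Hypothesis DU : Delta *m U = row_mx (S1 *m D2) D1.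

Let mpsi : {linear 'M[C]_(L, n + n) -> 'M[C]_(L, n + n)} :=
  (mulmxr E1 \o mulmx (cshift C L)) \+ mulmxr E2.
(** psi1 and psi2 commute, as both products are the cyclic shift, and they model
    S1 and S2 by [rel1] and [rel2]. *)
Let psi1 : {linear 'M[C]_(L, n + n) -> 'M[C]_(L, n + n)} := mpsi \o mulmxr U.
Let psi2 : {linear 'M[C]_(L, n + n) -> 'M[C]_(L, n + n)} := mulmxr (U^t*) \o mpsi.

Let psi1E Y : psi1 Y = psi (Y *m U). Proof. by []. Qed.
Let psi2E Y : psi2 Y = psi Y *m U^t*. Proof. by []. Qed.

Let iso_mulr (V : 'M[C]_(n + n)) : V \is unitarymx ->
  forall X Y : 'M[C]_(L, n + n), \tr (X *m V *m (Y *m V)^t*) = \tr (X *m Y^t*).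
Proof. by move=> uV X Y; rewrite trmxC_mul mulmxA mulmxtVK. Qed.

Let psi12 Y : psi1 (psi2 Y) = psi2 (psi1 Y).
Proof.
rewrite psi1E !psi2E -mulmxA (mulmx1C (unitarymxP uU)) mulmx1 psi1E !psi_psi.
by rewrite mulmxA mulmxtVK.
Qed.

(** All but the last j terms of Y are the defects of the orbit of x under T. *)
Let tracks j (Y : 'M[C]_(L, n + n)) (x : 'rV[C]_n) :=
  forall k : 'I_L, (k + j < L)%N -> row k Y = iter k (mulmxr T) x *m Delta.

Let iterT k (x : 'rV[C]_n) (S : 'M[C]_n) : T *m S = S *m T ->
  iter k (mulmxr T) (x *m S) = iter k (mulmxr T) x *m S.
Proof. by move=> TS; elim: k => //= k ->; rewrite -[LHS]mulmxA -[RHS]mulmxA TS. Qed.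

Let row_psi Y (k : 'I_L) : row k (psi Y) = row (ordS k) Y *m E1 + row k Y *m E2.
Proof. by rewrite linearD /= [row k (_ *m E1)]row_mul row_cshift row_mul. Qed.

Let ordSE (k : 'I_L) j : (k + j.+1 < L)%N -> ordS k = k.+1 :> nat.
Proof.
by move=> kj; rewrite /= modn_small // (leq_ltn_trans _ kj) // addnS ltnS leq_addr.
Qed.

Let rel1 : T *m (Delta *m U *m E1) + Delta *m U *m E2 = S1 *m Delta.
Proof.
rewrite DU !mul_row_block !mul_mx_row !(mulmx0, mulmx1, addr0, add0r).
by rewrite add_row_mx addr0 add0r mulmxA.
Qed.

Let rel2 : (T *m (Delta *m E1) + Delta *m E2) *m U^t* = S2 *m Delta.
Proof.
rewrite -[RHS](mulmxtVK _ uU) -(mulmxA S2) DU; congr (_ *m _).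
rewrite !mul_row_block !mul_mx_row !(mulmx0, mulmx1, addr0, add0r).
by rewrite add_row_mx addr0 add0r !mulmxA S12.
Qed.

Let tracks1 j Y x : tracks j Y x -> tracks j.+1 (psi1 Y) (x *m S1).
Proof.
move=> YX k kj; rewrite psi1E row_psi !row_mul.
rewrite !YX ?(ordSE kj) ?addSnnS //; last by rewrite (leq_trans _ kj) // ltnS leq_add2l.
rewrite [in RHS]iterT; last by rewrite -mulmxA -S12.
by rewrite -[RHS]mulmxA -rel1 mulmxDr /= !mulmxA.
Qed.

Let tracks2 j Y x : tracks j Y x -> tracks j.+1 (psi2 Y) (x *m S2).
Proof.
move=> YX k kj; rewrite psi2E row_mul row_psi.
rewrite !YX ?(ordSE kj) ?addSnnS //; last by rewrite (leq_trans _ kj) // ltnS leq_add2l.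
rewrite [in RHS]iterT; last by rewrite S12 -mulmxA S12.
by rewrite -[RHS]mulmxA -rel2 !mulmxDl mulmxDr /= !mulmxA.
Qed.

Let tracks_le j l Y x : (j <= l)%N -> tracks j Y x -> tracks l Y x.
Proof. by move=> jl YX k kl; apply: YX; apply: leq_ltn_trans kl; rewrite leq_add2l. Qed.

Let tracks_opoly (P : 'M[C]_N) Y x : tracks 0 Y x ->
  tracks (N + N) (opoly P psi1 psi2 Y) (opoly P (mulmxr S1) (mulmxr S2) x).
Proof.
move=> YX k kN.
pose tr (z : 'rV[C]_n) := iter k (mulmxr T) z *m Delta.
have trE z : tr z = z *m (iter k (mulmxr T) 1%:M *m Delta).
  rewrite /tr mulmxA; congr (_ *m _).
  by elim: (k : nat) => [|h IH]; rewrite ?mulmx1 // !iterS IH /= !mulmxA.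
rewrite -/(tr _) trE /opoly mulmx_suml raddf_sum; apply: eq_bigr => i _ /=.
rewrite mulmx_suml raddf_sum; apply: eq_bigr => j _ /=.
rewrite linearZ -scalemxAl -trE /=; congr (_ *: _).
have it h l f S Z z : (forall j Y x, tracks j Y x -> tracks j.+1 (f Y) (x *m S)) ->
    tracks h Z z -> tracks (h + l) (iter l f Z) (iter l (mulmxr S) z).
  by move=> fS Zz; elim: l => [|l IH]; rewrite ?addn0 // addnS; apply: fS.
have tij := it _ i _ _ _ _ tracks1 (it _ j _ _ _ _ tracks2 YX).
have ij : (0 + j + i <= N + N)%N by rewrite add0n leq_add // ltnW.
exact: (tracks_le ij tij).
Qed.

(** The isometric embedding of x as the sequence of the defects of x T^k turns
    p(S1, S2) into p(psi1, psi2), up to the last terms of the sequence. *)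
Lemma nilpotent_model (P : 'M[C]_N) beta (x : 'rV[C]_n) :
  (forall x : 'rV[C]_n, iter K (mulmxr T) x = 0) ->
  (forall a b : C, `|a| = 1 -> `|b| = 1 -> `|poly2 P a b| <= beta) ->
  energy (opoly P (mulmxr S1) (mulmxr S2) x) <= beta ^+ 2 * energy x.
Proof.
move=> nilT bP.
have e0 : energy 0 = 0 by rewrite /energy !mul0mx mxE.
have frob_rows m l (Z : 'M[C]_(m, l)) : frob Z = \sum_i frob (row i Z).
  rewrite frobE; apply: eq_bigr => i _; rewrite frobE big_ord1.
  by apply: eq_bigr => j _; rewrite mxE.
pose Y := \matrix_(k < L) (iter k (mulmxr T) x *m Delta).
have YX : tracks 0 Y x by move=> k _; rewrite rowK.
have EY : energy x = frob Y.
  rewrite (energy_sum L) /L [in energy _]addnC iterD nilT.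
  rewrite (_ : iter _ _ 0 = 0) ?e0 ?addr0; last first.
    by elim: (N + N)%N => //= h ->; rewrite mul0mx.
  by rewrite frob_rows; apply: eq_bigr => k _; rewrite rowK.
have -> := EY; rewrite (energy_sum K) nilT e0 addr0.
apply: le_trans (commuting_isometry_von_neumann Y _ _ psi12 bP); last 2 first.
- by move=> X Z; rewrite !psi1E psi_iso iso_mulr.
- by move=> X Z; rewrite !psi2E iso_mulr ?trmxC_unitary // psi_iso.
rewrite [leRHS]frob_rows /L big_split_ord /= ler_wpDr ?sumr_ge0 //.
  by move=> i _; apply: frob_ge0.
apply: ler_sum => k _; rewrite (tracks_opoly P YX) //.
by rewrite /= ltn_add2r.
Qed.

End Model.

(** Ando's theorem for nilpotent matrices and the seminorm of M, which need not be
    definite. *)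
Theorem finite_ando (P : 'M[C]_N) beta (x : 'rV[C]_n) :
  (forall x : 'rV[C]_n, iter K (mulmxr T) x = 0) ->
  (forall a b : C, `|a| = 1 -> `|b| = 1 -> `|poly2 P a b| <= beta) ->
  (opoly P (mulmxr S1) (mulmxr S2) x *m M *m
     (opoly P (mulmxr S1) (mulmxr S2) x)^t*) 0 0 <=
  beta ^+ 2 * (x *m M *m x^t*) 0 0.
Proof.
move=> nilT bP; have [|U uU DU] := @equal_gram_unitary _ _ _ Delta (row_mx (S1 *m D2) D1).
  rewrite defect_gram tr_row_mx map_col_mx mul_row_col -D1E.
  rewrite [(S1 *m D2)^t*]trmxC_mul mulmxA -(mulmxA S1 D2) -D2E.
  by rewrite mulmxBr mulmxBl [RHS]addrC subrKA trmxC_mul !mulmxA.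
by apply: (nilpotent_model uU DU).

Qed.

End FiniteAndo.

(** * Commuting contractions of a Hilbert space *)

Section Gram.
Local Open Scope sesquilinear_scope.
Variables (C : numClosedFieldType) (V : lmodType C) (dot : {dot V for Num.conj}).

Definition gram n (W : 'rV[C]_n -> V) : 'M[C]_n :=
  \matrix_(k, l) dot (W (delta_mx 0 k)) (W (delta_mx 0 l)).

Lemma gramE n (W : {linear 'rV[C]_n -> V}) x :
  (x *m gram W *m x^t*) 0 0 = dot (W x) (W x).
Proof.
have WE : W x = \sum_k x 0 k *: W (delta_mx 0 k).
  by rewrite {1}[x]row_sum_delta linear_sum; apply: eq_bigr => k _; rewrite linearZ.
rewrite [X in dot _ X]WE linear_sumr mxE; apply: eq_bigr => l _.
rewrite linearZr_LR /= WE linear_sumlz !mxE mulr_suml mulr_sumr; apply: eq_bigr => k _.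
have /= -> := linearZl_LR dot (W (delta_mx 0 l)) (x 0 k) (W (delta_mx 0 k)).
by rewrite mxE [RHS]mulrC.
Qed.

Lemma gram_herm n (W : {linear 'rV[C]_n -> V}) : (gram W)^t* = gram W.
Proof. by apply/matrixP => k l; rewrite !mxE [RHS]hermC expr0 mul1r. Qed.

End Gram.

Section BoxOrbit.
Local Open Scope sesquilinear_scope.
Variables (C : numClosedFieldType) (V : lmodType C) (dot : {dot V for Num.conj}).
Variables (T1 T2 : {linear V -> V}).
Hypothesis T12 : forall h, T1 (T2 h) = T2 (T1 h).
Hypothesis T1c : forall h, dot (T1 h) (T1 h) <= dot h h.
Hypothesis T2c : forall h, dot (T2 h) (T2 h) <= dot h h.
Variable (h : V) (q : nat).
Local Notation Q := q.+1.

(** The initial segment of sum_ij X_ij T1^i T2^j h. As long as s and t are at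
    most Q, [inord] meets no index out of range. *)
Definition truncation s t (X : 'M[C]_Q) : V :=
  \sum_(i < s) \sum_(j < t) X (inord i) (inord j) *: iter i T1 (iter j T2 h).

Let truncation_linear s t : linear (truncation s t).
Proof.
move=> a X Y; rewrite scaler_sumr -big_split /=; apply: eq_bigr => i _.
rewrite scaler_sumr -big_split /=; apply: eq_bigr => j _.
by rewrite !mxE scalerDl scalerA.
Qed.
HB.instance Definition _ s t :=
  GRing.isLinear.Build C 'M[C]_Q V _ (truncation s t) (truncation_linear s t).

Definition nshift : 'M[C]_Q := \matrix_(i, k) ((i : nat) == k.+1)%:R.

Let shift1 (X : 'M[C]_Q) s j : (s < Q)%N ->
  (nshift *m X) (inord s) j = if s is s'.+1 then X (inord s') j else 0.
Proof.
move=> sQ; rewrite mxE; case: s sQ => [|s] sQ.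
  by rewrite big1 // => k _; rewrite mxE inordK // mul0r.
have sQ' := ltnW sQ; rewrite (bigD1 (inord s)) //= mxE !inordK // eqxx mul1r.
rewrite big1 ?addr0 // => k ks; rewrite mxE inordK // eqSS.
rewrite (_ : (s == k) = false) ?mul0r //; apply: contra_neqF ks => /eqP ->.
by rewrite inord_val.
Qed.

(** Shifting the coefficients down turns the truncation at s into its image under
    T1, truncated at s + 1; this is the source of the contractivity below. *)
Let truncation_shift1 s t X : (s < Q)%N ->
  truncation s.+1 t (nshift *m X) = T1 (truncation s t X).
Proof.
move=> sQ; rewrite /truncation big_ord_recl /= big1 ?add0r => [|j _]; last first.
  by rewrite shift1 // scale0r.
rewrite linear_sum; apply: eq_bigr => i _ /=.
rewrite linear_sum; apply: eq_bigr => j _ /=.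
rewrite linearZ shift1 //; exact: leq_ltn_trans (ltn_ord i) sQ.
Qed.

Let truncation_shift2 s t X : (t < Q)%N ->
  truncation s t.+1 (X *m nshift^T) = T2 (truncation s t X).
Proof.
have sE j i : (X *m nshift^T) i j = (nshift *m X^T) j i.
  by rewrite !mxE; apply: eq_bigr => k _; rewrite !mxE mulrC.
move=> tQ; rewrite /truncation linear_sum; apply: eq_bigr => i _ /=.
rewrite big_ord_recl /= sE shift1 // scale0r add0r.
rewrite linear_sum; apply: eq_bigr => j _ /=.
rewrite linearZ sE shift1; last exact: leq_ltn_trans (ltn_ord j) tQ.
rewrite /= mxE; congr (_ *: _); elim: (i : nat) => //= k ->; exact: T12.
Qed.

Definition box_energy (X : 'M[C]_Q) : C :=
  \sum_(s < Q) \sum_(t < Q) dot (truncation s.+1 t.+1 X) (truncation s.+1 t.+1 X).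

Let sum_shift (F : nat -> C) : F 0%N = 0 -> (forall s, 0 <= F s) ->
  \sum_(s < Q) F s <= \sum_(s < Q) F s.+1.
Proof.
by move=> F0 Fp; rewrite big_ord_recl F0 add0r [leRHS]big_ord_recr /= ler_wpDr.
Qed.

Let truncation0 X t : truncation 0 t X = 0.
Proof. by rewrite /truncation big_ord0. Qed.

Let truncation00 X s : truncation s 0 X = 0.
Proof. by rewrite /truncation big1 // => i _; rewrite big_ord0. Qed.

Lemma box_energy_shift1 X : box_energy (nshift *m X) <= box_energy X.
Proof.
rewrite /box_energy exchange_big [leRHS]exchange_big /=; apply: ler_sum => t _.
pose F s := dot (truncation s t.+1 X) (truncation s t.+1 X).
apply: le_trans (@sum_shift F _ _).
- by apply: ler_sum => s _; rewrite truncation_shift1.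
- by rewrite /F truncation0 linear0r.
- by move=> s; apply: dnorm_ge0.
Qed.

Lemma box_energy_shift2 X : box_energy (X *m nshift^T) <= box_energy X.
Proof.
apply: ler_sum => s _.
pose F t := dot (truncation s.+1 t X) (truncation s.+1 t X).
apply: le_trans (@sum_shift F _ _).
- by apply: ler_sum => t _; rewrite truncation_shift2.
- by rewrite /F truncation00 linear0r.
- by move=> t; apply: dnorm_ge0.
Qed.

Definition box_gram : 'M[C]_(Q * Q) :=
  \sum_(s < Q) \sum_(t < Q) gram dot (truncation s.+1 t.+1 \o vec_mx).

Lemma box_gramE x : (x *m box_gram *m x^t*) 0 0 = box_energy (vec_mx x).
Proof.
rewrite /box_gram mulmx_sumr mulmx_suml summxE; apply: eq_bigr => s _.
rewrite mulmx_sumr mulmx_suml summxE; apply: eq_bigr => t _.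
by rewrite gramE.
Qed.

Lemma box_gram_herm : box_gram^t* = box_gram.
Proof.
rewrite /box_gram linear_sum [LHS]raddf_sum; apply: eq_bigr => s _ /=.
rewrite linear_sum [LHS]raddf_sum; apply: eq_bigr => t _ /=.
by rewrite gram_herm.
Qed.

Lemma nshift_nil (X : 'M[C]_Q) : iter Q (mulmx nshift) X = 0.
Proof.
suff H n : forall s j, (s < n)%N -> (s < Q)%N -> iter n (mulmx nshift) X (inord s) j = 0.
  by apply/matrixP => i j; rewrite -(inord_val i) H ?mxE.
elim: n => // n IH [|s] j sn sQ; rewrite iterS /= shift1 //.
by apply: IH => //; apply: ltnW.
Qed.

Lemma nshift_delta i j : (i < Q)%N -> (j < Q)%N ->
  iter i (mulmx nshift) (iter j (mulmxr nshift^T) (delta_mx (inord 0) (inord 0))) =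
  delta_mx (inord i) (inord j).
Proof.
have H k (l : 'I_Q) : (k < Q)%N ->
    iter k (mulmx nshift) (delta_mx (inord 0) l) = delta_mx (inord k) l.
  elim: k => // k IH kQ; rewrite iterS IH 1?ltnW //.
  apply/matrixP => a b; rewrite -[a]inord_val /= shift1 //.
  have := ltn_ord a; case: (a : nat) => [|a'] aQ;
    by rewrite !mxE -!val_eqE /= !inordK ?eqSS // 1?ltnW.
have H' k (l : 'I_Q) : (k < Q)%N ->
    iter k (mulmxr nshift^T) (delta_mx l (inord 0)) = delta_mx l (inord k).
  move=> kQ; apply: trmx_inj; rewrite (iter_semiconj (f' := mulmx nshift) _ _ (h := trmx)).
    by rewrite !trmx_delta H.
  by move=> X; rewrite /= trmx_mul trmxK.
by move=> iQ jQ; rewrite H' // H.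
Qed.

Lemma truncation_delta i j s t : (i < Q)%N -> (j < Q)%N -> (s <= Q)%N -> (t <= Q)%N ->
  truncation s t (delta_mx (inord i) (inord j)) =
  if ((i < s) && (j < t))%N then iter i T1 (iter j T2 h) else 0.
Proof.
move=> iQ jQ sQ tQ; rewrite /truncation.
have E (a : 'I_s) (b : 'I_t) :
    (delta_mx (inord i) (inord j) : 'M[C]_Q) (inord a) (inord b) =
    ((a == i :> nat) && (b == j :> nat))%:R.
  have aQ := leq_trans (ltn_ord a) sQ; have bQ := leq_trans (ltn_ord b) tQ.
  by rewrite mxE -!val_eqE /= !inordK.
case: ifP => [/andP[is_ jt]|ij].
  rewrite (bigD1 (Ordinal is_)) // (bigD1 (Ordinal jt)) // E !eqxx scale1r.
  rewrite big1 => [|b bj]; last by rewrite E (negbTE (bj : b != j :> nat)) andbF scale0r.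
  rewrite /= addr0 big1 ?addr0 //= => a ai; rewrite big1 // => b _.
  by rewrite E (negbTE (ai : a != i :> nat)) scale0r.
rewrite big1 // => a _; rewrite big1 // => b _; rewrite E.
case: eqP => [ai|]; last by rewrite scale0r.
case: eqP => [bj|]; last by rewrite scale0r.
by move: ij; rewrite -ai -bj !ltn_ord.
Qed.

(** [finite_ando] for the two shifts of arrays and the box energy. The array with a
    single 1 has energy Q * Q |h|^2; the array of P is obtained from it by
    applying P to the shifts, and (Q - N)^2 at least of its truncations are
    complete. *)
Lemma box_ando N (P : 'M[C]_N) beta : (N <= Q)%N ->
  (forall a b : C, `|a| = 1 -> `|b| = 1 -> `|poly2 P a b| <= beta) ->
  dot (opoly P T1 T2 h) (opoly P T1 T2 h) *+ ((Q - N) * (Q - N)) <=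
  beta ^+ 2 * (dot h h *+ (Q * Q)).
Proof.
move=> NQ bP.
pose S1 := lin_mx (mulmx nshift) : 'M[C]_(Q * Q).
pose S2 := lin_mx (mulmxr nshift^T) : 'M[C]_(Q * Q).
have S12 : S1 *m S2 = S2 *m S1.
  apply/row_matrixP => i; rewrite !row_mul !rowE -!mulmxA.
  by rewrite -(vec_mxK (delta_mx 0 i)) !mulmxA !mul_vec_lin /= mulmxA.
have defect (S : 'M[C]_(Q * Q)) :
    (forall x, box_energy (vec_mx (x *m S)) <= box_energy (vec_mx x)) ->
    exists D : 'M[C]_(Q * Q), box_gram - S *m box_gram *m S^t* = D *m D^t*.
  move=> Sc; apply: psd_factorization => [|x].
    by rewrite linearB /= map_mxB !trmxC_mul trmxCK box_gram_herm mulmxA.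
  rewrite mulmxBr mulmxBl !mulmxA -(mulmxA _ (S^t*)) -trmxC_mul mxE [X in _ + X]mxE.
  by rewrite !box_gramE subr_ge0.
have [|D1 D1E] := defect S1; first by move=> x; rewrite mx_rV_lin box_energy_shift1.
have [|D2 D2E] := defect S2; first by move=> x; rewrite mx_rV_lin box_energy_shift2.
have nilT (x : 'rV_(Q * Q)) : iter Q (mulmxr (S1 *m S2)) x = 0.
  pose shift X := nshift *m X *m nshift^T.
  rewrite -[x]vec_mxK -(iter_semiconj (h := mxvec) (f := shift)); last first.
    by move=> X; rewrite /= mulmxA !mul_vec_lin.
  have -> k X : iter k shift X =
      iter k (mulmx nshift) (iter k (mulmxr nshift^T) X).
    elim: k => //= k ->; rewrite /shift -mulmxA; congr (_ *m _).
    apply: (iter_semiconj (h := mulmxr nshift^T) (f' := mulmx nshift)) => Y.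
    by rewrite /= mulmxA.
  by rewrite nshift_nil linear0.
pose e := mxvec (delta_mx (inord 0) (inord 0) : 'M[C]_Q).
have := finite_ando S12 D1E D2E e nilT bP; rewrite !box_gramE.
have -> : vec_mx (opoly P (mulmxr S1) (mulmxr S2) e) =
   \sum_(i < N) \sum_(j < N) P i j *: delta_mx (inord i) (inord j).
  rewrite (opoly_semiconj _ _ (f' := mulmx nshift) (g' := mulmxr nshift^T)); last 2 first.
  - by move=> x; rewrite /= mx_rV_lin.
  - by move=> x; rewrite /= mx_rV_lin.
  rewrite /= mxvecK; apply: eq_bigr => i _; apply: eq_bigr => j _.
  by rewrite nshift_delta // (leq_trans (ltn_ord _) NQ).
rewrite mxvecK; set Y := \sum_i _.
have -> : box_energy (delta_mx (inord 0) (inord 0)) = dot h h *+ (Q * Q).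
  rewrite /box_energy (eq_bigr (fun=> dot h h *+ Q)) => [|s _].
    by rewrite sumr_const card_ord mulrnA.
  rewrite (eq_bigr (fun=> dot h h)) => [|t _]; first by rewrite sumr_const card_ord.
  by rewrite truncation_delta.
apply: le_trans; rewrite /box_energy.
have YE s t : (N <= s <= Q)%N -> (N <= t <= Q)%N -> truncation s t Y = opoly P T1 T2 h.
  move=> /andP[Ns sQ] /andP[Nt tQ]; rewrite linear_sum; apply: eq_bigr => i _ /=.
  rewrite linear_sum; apply: eq_bigr => j _ /=; rewrite linearZ /= truncation_delta //.
  - by rewrite !(leq_trans (ltn_ord _)).
  - by rewrite (leq_trans (ltn_ord _)).
  - by rewrite (leq_trans (ltn_ord _)).
have big_tail (F : nat -> C) a : (forall s, 0 <= F s) ->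
    (forall s, (N <= s < Q)%N -> F s >= a) -> \sum_(s < Q) F s >= a *+ (Q - N).
  move=> F0 Fa; rewrite -(big_mkord xpredT F) (big_cat_nat (n := N)) //=.
  rewrite ler_wpDl ?sumr_ge0 // -sumr_const_nat big_seq [leRHS]big_seq.
  by apply: ler_sum => s; rewrite mem_index_iota; apply: Fa.
pose F s t := dot (truncation s.+1 t.+1 Y) (truncation s.+1 t.+1 Y).
rewrite mulrnA; apply: (big_tail (fun s => \sum_(t < Q) F s t)) => [s|s /andP[Ns sQ]].
  by rewrite sumr_ge0 // => t _; apply: dnorm_ge0.
apply: (big_tail (F s)) => [t|t /andP[Nt tQ]]; first exact: dnorm_ge0.
by rewrite /F YE // ?sQ ?tQ andbT ltnW.
Qed.

End BoxOrbit.

(** * Norms with real values *)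

Section Rnorm.
Variables (R : realType) (V : normedZmodType R[i]).
Implicit Types (x y : V).

Lemma rnormE x : `|x| = (rnorm x)%:C%C.
Proof. by rewrite /rnorm RRe_real // normr_real. Qed.

Lemma rnorm_ge0 x : 0 <= rnorm x.
Proof. by rewrite -ler0c -rnormE normr_ge0. Qed.

Lemma rnormD x y : rnorm (x + y) <= rnorm x + rnorm y.
Proof. by rewrite -lecR rmorphD /= -!rnormE ler_normD. Qed.

Lemma rnorm0 : rnorm (0 : V) = 0.
Proof. by apply: complexI; rewrite -rnormE normr0. Qed.

Lemma rnormN x : rnorm (- x) = rnorm x.
Proof. by apply: complexI; rewrite -!rnormE normrN. Qed.

Lemma rnormB x y : rnorm (x - y) = rnorm (y - x).
Proof. by rewrite -rnormN opprB. Qed.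

Lemma rnorm_eq0 x : (rnorm x == 0) = (x == 0).
Proof. by rewrite -[RHS]normr_eq0 rnormE -[LHS](inj_eq (@complexI R)). Qed.

Lemma rnorm_sum I r (P : pred I) (F : I -> V) :
  rnorm (\sum_(i <- r | P i) F i) <= \sum_(i <- r | P i) rnorm (F i).
Proof.
elim/big_ind2: _ => [|x a y b xa yb|//]; first by rewrite rnorm0.
by rewrite (le_trans (rnormD _ _)) // lerD.
Qed.

End Rnorm.

Lemma rnormZ (R : realType) (V : normedModType R[i]) (a : R[i]) (x : V) :
  rnorm (a *: x) = rnorm a * rnorm x.
Proof. by apply: complexI; rewrite rmorphM /= -!rnormE normrZ. Qed.

Lemma rnormM (R : realType) (a b : R[i]) : rnorm (a * b) = rnorm a * rnorm b.
Proof. by apply: complexI; rewrite rmorphM /= -!rnormE normrM. Qed.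

Lemma rnormX (R : realType) (a : R[i]) n : rnorm (a ^+ n) = rnorm a ^+ n.
Proof. by apply: complexI; rewrite rmorphXn /= -!rnormE normrX. Qed.

Lemma rnormR (R : realType) (a : R) : rnorm (a%:C%C) = `|a|.
Proof. by rewrite /rnorm normc_def /= expr0n addr0 sqrtr_sqr. Qed.

Lemma sum_fset_cover (R : realDomainType) (I : choiceType) (J : finType)
    (g : J -> I) (A : {fset I}) (Q : pred J) (F : I -> R) :
  (forall a, 0 <= F a) -> (forall a, a \in A -> exists2 j, Q j & g j = a) ->
  \sum_(a <- A) F a <= \sum_(j | Q j) F (g j).
Proof.
move=> F0 cov.
apply: (@le_trans _ _ (\sum_(a <- A) \sum_(j | Q j && (g j == a)) F (g j))).
  rewrite big_seq [leRHS]big_seq; apply: ler_sum => a /cov[j Qj <-].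
  by rewrite (bigD1 j) ?Qj ?eqxx //= lerDl sumr_ge0.
rewrite (exchange_big_dep Q) /=; last by move=> a j _ /andP[].
apply: ler_sum => j Qj; under eq_bigl do rewrite Qj /=.
rewrite big_const_seq iter_addr_0 -[leRHS]mulr1n.
rewrite ler_wpMn2l // (_ : count _ _ = count_mem (g j) A); last first.
  by apply: eq_count => a /=; rewrite eq_sym.
by rewrite count_uniq_mem ?fset_uniq // leq_b1.
Qed.

Section DoubleIndex.

Definition mk2 (i j : nat) : multi_index 2 := [ffun k : 'I_2 => if k == 0 then i else j].

Lemma mk2_0 i j : mk2 i j 0 = i. Proof. by rewrite ffunE. Qed.
Lemma mk2_1 i j : mk2 i j 1 = j. Proof. by rewrite ffunE. Qed.

Lemma mk2K (a : multi_index 2) : mk2 (a 0) (a 1) = a.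
Proof.
apply/ffunP => k; rewrite ffunE; case: (unliftP 0 k) => [l ->|->]; last by rewrite eqxx.
by rewrite (_ : lift 0 l = 1) //; apply: val_inj; rewrite /= ord1.
Qed.

Lemma mk2_inj : forall i j k l, mk2 i j = mk2 k l -> i = k /\ j = l.
Proof. by move=> i j k l /ffunP e; have := (e 0, e 1); rewrite !ffunE /= => -[-> ->]. Qed.

Lemma mdegree_mk2 i j : mdegree (mk2 i j) = (i + j)%N.
Proof. by rewrite /mdegree big_ord_recl big_ord1 !ffunE. Qed.

Lemma monomial_mk2 (R : realType) (z : 'rV[R[i]]_2) i j :
  monomial z (mk2 i j) = z 0 0 ^+ i * z 0 1 ^+ j.
Proof.
rewrite /monomial big_ord_recl big_ord1 !ffunE /=.
by congr (_ * z 0 _ ^+ _); apply: val_inj.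
Qed.

Definition box (N : nat) : {fset multi_index 2} :=
  seq_fset tt [seq mk2 i j | i <- iota 0 N, j <- iota 0 N].

Lemma in_box N a : (a \in box N) = ((a 0%R < N) && (a 1%R < N))%N.
Proof.
rewrite /box seq_fsetE; apply/allpairsP/andP => [[[i j]] /= [] + + ->|[a0 a1]].
  by rewrite !mem_iota mk2_0 mk2_1.
by exists (a 0, a 1); rewrite /= !mem_iota mk2K.
Qed.

Lemma sum_box (V : nmodType) N (F : multi_index 2 -> V) :
  \sum_(a <- box N) F a = \sum_(i < N) \sum_(j < N) F (mk2 i j).
Proof.
have iotaE k : iota 0 k = index_iota 0 k by rewrite /index_iota subn0.
rewrite (perm_big _ (seq_fset_perm _ _)) undup_id; last first.
  apply: allpairs_uniq; rewrite ?iota_uniq //.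
  by move=> [i j] [k l] _ _ /= /mk2_inj[-> ->].
rewrite big_allpairs_dep /= !iotaE big_mkord; apply: eq_bigr => i _.
by rewrite big_mkord.
Qed.

Lemma box_mono N M : (N <= M)%N -> (box N `<=` box M)%fset.
Proof.
move=> NM; apply/fsubsetP => a; rewrite !in_box => /andP[a0 a1].
by rewrite !(leq_trans _ NM).
Qed.

Lemma sub_box (A : {fset multi_index 2}) :
  exists N, forall M, (N <= M)%N -> (A `<=` box M)%fset.
Proof.
exists (\max_(a <- A) (maxn (a 0%R) (a 1%R))).+1 => M NM.
apply/fsubsetP => a aA; rewrite in_box -gtn_max; apply: leq_trans NM.
rewrite ltnS.
by apply: (@leq_bigmax_seq _ _ xpredT (fun a : multi_index 2 => maxn (a 0) (a 1))).
Qed.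

End DoubleIndex.

Lemma partial_sumE (I : choiceType) (V : zmodType) (F : I -> V) (A : {fset I}) :
  partial_sum F A = \sum_(a <- A) F a.
Proof. by rewrite /partial_sum big_seq_fsetE. Qed.

Lemma sum_fsubset (I : choiceType) (V : zmodType) (F : I -> V) (A B : {fset I}) :
  (A `<=` B)%fset ->
  \sum_(a <- B) F a - \sum_(a <- A) F a = \sum_(a <- (B `\` A)%fset) F a.
Proof.
move=> AB; rewrite (big_fsetID _ (mem A) B) /=.
rewrite (_ : [fset x in B | x \in A]%fset = A); last first.
  apply/fsetP => x; rewrite !inE; apply/andP/idP => [[]|xA] //.
  by split=> //; apply: (fsubsetP AB).
rewrite addrAC subrr add0r; congr (\sum_(a <- _) _).
by congr enum_fset; apply/fsetP => x; rewrite !inE andbC.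
Qed.

(** * Coefficients and truncations of a bounded power series *)

Lemma ler_sum_fset (R : realDomainType) (I : choiceType) (A B : {fset I}) (F : I -> R) :
  (forall a, 0 <= F a) -> (A `<=` B)%fset -> \sum_(a <- A) F a <= \sum_(a <- B) F a.
Proof. by move=> F0 AB; rewrite -subr_ge0 sum_fsubset // sumr_ge0. Qed.

Lemma geometric_tail (R : realFieldType) (u : R) N (A : {fset multi_index 2}) :
  0 <= u < 1 -> (forall a, a \in A -> a \notin box N) ->
  \sum_(a <- A) u ^+ mdegree a <= u ^+ N * (2 / (1 - u) ^+ 2).
Proof.
move=> /andP[u0 u1] AN; have [M0 /(_ (maxn M0 N) (leq_maxl _ _))] := sub_box A.
set M := maxn M0 N => AM; have NM : (N <= M)%N by apply: leq_maxr.
apply: (@le_trans _ _ (\sum_(a <- (box M `\` box N)%fset) u ^+ mdegree a)).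
  apply: ler_sum_fset => [a|]; first exact: exprn_ge0.
  by apply/fsubsetP => a aA; rewrite !inE AN // (fsubsetP AM).
rewrite -sum_fsubset ?box_mono // !sum_box.
pose g n := \sum_(i < n) u ^+ i.
have gE n : g n = (1 - u ^+ n) / (1 - u).
  apply: (canRL (mulfK _)); first by rewrite subr_eq0 gt_eqF.
  by rewrite -[RHS]opprB subrX1 -mulNr opprB mulrC.
have gg n : \sum_(i < n) \sum_(j < n) u ^+ mdegree (mk2 i j) = g n ^+ 2.
  rewrite expr2 mulr_suml; apply: eq_bigr => i _; rewrite mulr_sumr.
  by apply: eq_bigr => j _; rewrite mdegree_mk2 exprD.
rewrite !gg !gE.
have uM : 0 <= u ^+ M by exact: exprn_ge0.
have uN : 0 <= u ^+ N by exact: exprn_ge0.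
have v0 : 0 < (1 - u) ^- 2 by rewrite invr_gt0 exprn_gt0 // subr_gt0.
rewrite !expr_div_n -mulrBl mulrA ler_pM2r //.
have uM1 : u ^+ M <= 1 by rewrite exprn_ile1 // ltW.
have uN1 : u ^+ N <= 1 by rewrite exprn_ile1 // ltW.
nra.
Qed.

Section Coefficients.
Variables (R : realType) (f : 'rV[R[i]]_2 -> R[i]) (c : multi_index 2 -> R[i]).
Hypothesis fc : expansion f c.

Lemma rnorm_monomial (z : 'rV[R[i]]_2) (s : R) a : (forall i, rnorm (z 0 i) = s) ->
  rnorm (monomial z a) = s ^+ mdegree a.
Proof.
by move=> zs; rewrite -(mk2K a) monomial_mk2 mdegree_mk2 rnormM !rnormX !zs exprD.
Qed.

Lemma expansion_near z (e : R) : polydisk z -> 0 < e -> exists A0 : {fset multi_index 2},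
  forall A, (A0 `<=` A)%fset -> rnorm (f z - \sum_(a <- A) c a * monomial z a) < e.
Proof.
move=> /fc /cvgrPdist_lt /(_ e%:C%C); rewrite ltcR => fe /fe [A0 _ A0P].
exists A0 => A /A0P /=.
by rewrite partial_sumE rnormE ltcR.
Qed.

(** The terms of a convergent unordered sum are bounded: beyond a finite set A0
    each of them is a difference of two partial sums that are close to the limit. *)
Lemma coef_bound (s : R) : 0 <= s < 1 ->
  exists2 B, 0 <= B & forall a, rnorm (c a) * s ^+ mdegree a <= B.
Proof.
move=> /andP[s0 s1]; pose z : 'rV[R[i]]_2 := const_mx s%:C%C.
have zs i : rnorm (z 0 i) = s by rewrite mxE rnormR ger0_norm.
have Dz : polydisk z by move=> i; rewrite rnormE zs ltcR.
have [A0 A0P] := expansion_near Dz ltr01.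
have tE a : rnorm (c a) * s ^+ mdegree a = rnorm (c a * monomial z a).
  by rewrite rnormM (rnorm_monomial _ zs).
exists (2 + \sum_(a <- A0) rnorm (c a * monomial z a)).
  by rewrite addr_ge0 // sumr_ge0 // => a _; apply: rnorm_ge0.
move=> a; rewrite tE; have [aA|aA] := boolP (a \in A0).
  rewrite (big_fsetD1 a) //= addrCA lerDl addr_ge0 // sumr_ge0 // => b _; exact: rnorm_ge0.
rewrite -[leLHS]addr0 lerD //; last by rewrite sumr_ge0 // => b _; apply: rnorm_ge0.
have := A0P _ (fsubsetU1 a A0); rewrite big_fsetU1 //= => h1.
have h2 := A0P _ (fsubset_refl A0).
set t := c a * _ in h1 *; set S := \sum_(_ <- _) _ in h1 h2.
have -> : t = (f z - S) - (f z - (t + S)) by ring.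
by rewrite (le_trans (rnormD _ _)) // rnormN; lra.
Qed.

(** Comparison with a geometric series, from the bound on the coefficients at a
    radius s between t and 1. This gives the absolute convergence that the
    unordered sums do not state. *)
Lemma coef_tail (t e : R) : 0 <= t < 1 -> 0 < e ->
  exists N, forall A : {fset multi_index 2}, (forall a, a \in A -> a \notin box N) ->
  \sum_(a <- A) rnorm (c a) * t ^+ mdegree a <= e.
Proof.
move=> /andP[t0 t1] e0.
pose s := (1 + t) / 2; have s1 : s < 1 by rewrite /s; lra.
have s0 : 0 < s by rewrite /s; lra.
have [|B B0 Bc] := @coef_bound s; first by rewrite ltW.
pose u := t / s; have u0 : 0 <= u by rewrite divr_ge0 // ltW.
have u1 : u < 1 by rewrite ltr_pdivrMr // mul1r /s; lra.
pose K := B * (2 / (1 - u) ^+ 2).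
have K0 : 0 <= K.
  by rewrite mulr_ge0 // divr_ge0 // exprn_ge0 // subr_ge0 ltW.
have [N uN] : exists N, u ^+ N * K <= e.
  have /cvgrPdist_lt/(_ (e / (K + 1))) : u ^+ n @[n --> \oo] --> (0 : R).
    by apply: cvg_expr; rewrite ger0_norm.
  have K1 : 0 < K + 1 by lra.
  rewrite divr_gt0 // => /(_ isT)[N _ /(_ N (leqnn _))] /=.
  rewrite sub0r normrN ger0_norm ?exprn_ge0 // ltr_pdivlMr // => h; exists N.
  have uN : 0 <= u ^+ N by rewrite exprn_ge0.
  lra.
exists N => A AN; apply: le_trans uN; rewrite /K mulrCA.
apply: (@le_trans _ _ (B * \sum_(a <- A) u ^+ mdegree a)); last first.
  by rewrite ler_wpM2l // geometric_tail // u0.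
rewrite mulr_sumr; apply: ler_sum => a _.
rewrite (_ : t = s * u); last by rewrite /u mulrC divfK // gt_eqF.
by rewrite exprMn mulrA ler_wpM2r // exprn_ge0.
Qed.

(** The polynomial of f(t z) with all exponents less than N. *)
Definition box_poly (t : R) N : 'M[R[i]]_N :=
  \matrix_(i, j) (c (mk2 i j) * (t ^+ (i + j))%:C%C).

Lemma box_poly_bound (t e : R) : 0 <= t < 1 -> 0 < e ->
  (forall z, polydisk z -> `|f z| <= 1) ->
  exists N0, forall N, (N0 <= N)%N -> forall a b : R[i], `|a| = 1 -> `|b| = 1 ->
  `|poly2 (box_poly t N) a b| <= (1 + e)%:C%C.
Proof.
move=> t01 e0 f1; have /andP[t0 t1] := t01.
have [N0 N0P] := coef_tail t01 e0; exists N0 => N N0N a b a1 b1.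
pose z : 'rV[R[i]]_2 := \row_i (t%:C%C * if i == 0 then a else b).
have zs i : rnorm (z 0 i) = t.
  rewrite mxE rnormM rnormR ger0_norm //; apply: complexI.
  by rewrite rmorphM /= -rnormE; case: ifP => _; rewrite ?a1 ?b1 mulr1.
have Dz : polydisk z by move=> i; rewrite rnormE zs ltcR.
have -> : poly2 (box_poly t N) a b = \sum_(m <- box N) c m * monomial z m.
  rewrite sum_box; apply: eq_bigr => i _; apply: eq_bigr => j _.
  by rewrite monomial_mk2 !mxE /= !exprMn exprD !rmorphM /= !rmorphXn /=; ring.
rewrite rnormE lecR; apply/ler_addgt0Pr => e' e'0.
have [A0 A0P] := expansion_near Dz e'0.
have [M0 /(_ (maxn M0 N) (leq_maxl _ _))] := sub_box A0.
set M := maxn M0 N => AM; have NM : (N <= M)%N by apply: leq_maxr.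
have h1 := A0P _ AM; have h2 := f1 _ Dz; rewrite rnormE lecR in h2.
set S := (X in rnorm (_ - X)) in h1; set s := (X in rnorm X).
have h3 : rnorm (S - s) <= e.
  rewrite /S /s sum_fsubset ?box_mono // (le_trans (rnorm_sum _ _ _)) //.
  under eq_bigr do rewrite rnormM (rnorm_monomial _ zs).
  apply: N0P => m; rewrite inE => /andP[+ _].
  by apply: contra; apply: fsubsetP; apply: box_mono.
have -> : s = f z - ((f z - S) + (S - s)) by ring.
have := rnormD (f z) (- ((f z - S) + (S - s))); rewrite rnormN.
by have := rnormD (f z - S) (S - s); lra.
Qed.

End Coefficients.

(** * Bounded functions on the bidisk belong to the Agler class *)

Lemma ler_of_shifted_squares (R : archiRealFieldType) (a b : R) (N : nat) :
  0 <= b -> (forall m : nat, a * m.+1%:R ^+ 2 <= b * (N%:R + m.+1%:R) ^+ 2) -> a <= b.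
Proof.
move=> b0 ab; rewrite leNgt; apply/negP => ba.
have d0 : 0 < a - b by rewrite subr_gt0.
pose K := b * (N%:R * 2 + N%:R ^+ 2).
have N0 : 0 <= N%:R :> R by [].
have := archi_boundP (_ : 0 <= K / (a - b)); set m := Num.bound _ => /(_ _) mb.
have {}mb : K / (a - b) < m%:R.
  by apply: mb; rewrite divr_ge0 ?(ltW d0) // mulr_ge0 // addr_ge0 ?mulr_ge0 ?exprn_ge0.
rewrite ltr_pdivrMr // in mb.
have := ab m; set k : R := m.+1%:R => h.
have k1 : 1 <= k by rewrite ler1n.
have mk : m%:R <= k by rewrite ler_nat.
have h1 : (a - b) * k ^+ 2 <= b * (N%:R * 2 * k + N%:R ^+ 2) by lra.
have h2 : b * (N%:R * 2 * k + N%:R ^+ 2) <= K * k.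
  rewrite /K -[leRHS]mulrA ler_wpM2l //.
  have : 0 <= N%:R ^+ 2 * (k - 1) by rewrite mulr_ge0 ?exprn_ge0 ?subr_ge0.
  lra.
have h3 : K * k < (a - b) * k ^+ 2.
  have : K < (a - b) * k by apply: lt_le_trans mb _; rewrite mulrC ler_pM2l.
  by rewrite expr2 mulrA ltr_pM2r //; lra.
lra.
Qed.
(** As Q tends to infinity in [box_ando], the quotient of Q * Q by (Q - N)^2 tends
    to 1. *)
Lemma hilbert_ando (R : realType) (H : completeNormedModType R[i])
    (dot : {dot H for Num.conj}) (T1 T2 : {linear H -> H})
    N (P : 'M[R[i]]_N) (beta : R) h :
  hilbert_norm dot -> (forall h, T1 (T2 h) = T2 (T1 h)) ->
  (forall h, rnorm (T1 h) <= rnorm h) -> (forall h, rnorm (T2 h) <= rnorm h) ->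
  (forall a b : R[i], `|a| = 1 -> `|b| = 1 -> `|poly2 P a b| <= beta%:C%C) ->
  rnorm (opoly P T1 T2 h) <= beta * rnorm h.
Proof.
move=> hn T12 T1c T2c bP.
have dotE x : dot x x = (rnorm x ^+ 2)%:C%C by rewrite -hn rnormE rmorphXn.
have dc (T : {linear H -> H}) : (forall h, rnorm (T h) <= rnorm h) ->
    forall h, dot (T h) (T h) <= dot h h.
  by move=> Tc x; rewrite !dotE lecR lerXn2r ?nnegrE ?rnorm_ge0.
have b0 : 0 <= beta.
  rewrite -ler0c; apply: le_trans (bP 1 1 _ _); by rewrite ?normr1.
rewrite -(@ler_pXn2r _ 2) ?nnegrE ?mulr_ge0 ?rnorm_ge0 // exprMn.
apply: (@ler_of_shifted_squares _ _ _ N) => [|m].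
  by rewrite mulr_ge0 ?exprn_ge0 ?rnorm_ge0.
have := @box_ando _ _ dot T1 T2 T12 (dc _ T1c) (dc _ T2c) h (N + m) N P beta%:C%C.
rewrite !dotE. have CM (x : R) n : x%:C%C *+ n = (x *+ n)%:C%C by rewrite rmorphMn.
rewrite !CM. rewrite -rmorphXn -rmorphM lecR.
move=> /(_ (leqW (leq_addr _ _)) bP).
rewrite -addnS addKn -!(mulr_natr (_ ^+ 2)) !natrM -!expr2 natrD => h1.
by rewrite -[leRHS]mulrA.
Qed.

Lemma opnorm_le (R : realType) (H : normedModType R[i]) (G : H -> H) (e : R) : 0 <= e ->
  (forall h, rnorm (G h) <= e * rnorm h) -> (opnorm G <= e%:E)%E.
Proof.
move=> e0 Ge; apply: ge_ereal_sup => _ /= [h h1 <-]; rewrite lee_fin (le_trans (Ge h)) //.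
by rewrite -[leRHS]mulr1 ler_wpM2l // -lecR -rnormE.
Qed.

Lemma opnorm_ge0 (R : realType) (H : normedModType R[i]) (G : H -> H) : (0 <= opnorm G)%E.
Proof.
apply: (@le_trans _ _ (rnorm (G 0))%:E); first by rewrite lee_fin rnorm_ge0.
by apply: ereal_sup_ubound; exists 0 => //=; rewrite normr0.
Qed.

Section AglerSum.
Variables (R : realType) (f : 'rV[R[i]]_2 -> R[i]) (c : multi_index 2 -> R[i]).
Hypothesis fc : expansion f c.
Hypothesis f1 : forall z, polydisk z -> `|f z| <= 1.
Variables (H : completeNormedModType R[i]) (dot : {dot H for Num.conj}).
Hypothesis hn : hilbert_norm dot.
Variable T : 'I_2 -> {linear H -> H}.
Hypothesis Tcomm : forall i j h, T i (T j h) = T j (T i h).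
Variable t : R.
Hypothesis t01 : 0 < t < 1.
Hypothesis Tt : forall i h, rnorm (T i h) <= t * rnorm h.

Let t0 : 0 < t. Proof. by case/andP: t01. Qed.
Let t01' : 0 <= t < 1. Proof. by case/andP: t01 => /ltW -> ->. Qed.

Lemma op_monomial_mk2 i j h : op_monomial T (mk2 i j) h = iter i (T 0) (iter j (T 1) h).
Proof.
rewrite /op_monomial !big_ord_recl big_ord0 /= !ffunE /=.
by congr (iter _ _ (iter _ (T _) _)); apply: val_inj.
Qed.

Lemma rnorm_op_monomial a h : rnorm (op_monomial T a h) <= t ^+ mdegree a * rnorm h.
Proof.
rewrite -(mk2K a) op_monomial_mk2 mdegree_mk2 exprD -mulrA.
have it i n x : rnorm (iter n (T i) x) <= t ^+ n * rnorm x.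
  elim: n => [|n IH]; first by rewrite mul1r.
  by rewrite iterS (le_trans (Tt _ _)) // exprS -mulrA ler_pM2l.
by rewrite (le_trans (it _ _ _)) // ler_wpM2l // exprn_ge0 // ltW.
Qed.

Definition box_op N h := \sum_(a <- box N) c a *: op_monomial T a h.

(** Von Neumann's inequality for the contractions T i / t and the polynomials
    [box_poly]. *)
Lemma box_op_bound (e : R) : 0 < e -> exists N0, forall N, (N0 <= N)%N -> forall h,
  rnorm (box_op N h) <= (1 + e) * rnorm h.
Proof.
move=> e0; have [N0 N0P] := box_poly_bound fc t01' e0 f1; exists N0 => N /N0P bP h.
pose U i : {linear H -> H} := (t^-1)%:C%C \*: T i.
have it i n x : iter n (T i) x = (t ^+ n)%:C%C *: iter n (U i) x.
  elim: n => [|n IH]; first by rewrite scale1r.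
  rewrite !iterS IH linearZ /= /U /= scalerA -rmorphM exprSr mulfK //; exact: lt0r_neq0.
have itZ k n a x : iter n (U k) (a *: x) = a *: iter n (U k) x.
  by elim: n => [//|n IH]; rewrite !iterS IH linearZ.
have -> : box_op N h = opoly (box_poly c t N) (U 0) (U 1) h.
  rewrite /box_op sum_box; apply: eq_bigr => i _; apply: eq_bigr => j _.
  by rewrite op_monomial_mk2 !it itZ mxE !scalerA exprD rmorphM /= mulrA.
apply: (hilbert_ando (dot := dot)) => // [x|x|x].
- by rewrite /U /= !linearZ /= Tcomm.
- rewrite /U /= rnormZ rnormR ger0_norm ?invr_ge0 ?(ltW t0) //.
  by rewrite mulrC ler_pdivrMr // mulrC.
- rewrite /U /= rnormZ rnormR ger0_norm ?invr_ge0 ?(ltW t0) //.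
  by rewrite mulrC ler_pdivrMr // mulrC.
Qed.

Lemma box_op_tail (e : R) : 0 < e -> exists N, forall A : {fset multi_index 2},
  (forall a, a \in A -> a \notin box N) ->
  forall h, rnorm (\sum_(a <- A) c a *: op_monomial T a h) <= e * rnorm h.
Proof.
move=> e0; have [N NP] := coef_tail fc t01' e0; exists N => A /NP Ae h.
apply: le_trans (rnorm_sum _ _ _) _.
apply: (@le_trans _ _ (\sum_(a <- A) rnorm (c a) * t ^+ mdegree a * rnorm h)).
  apply: ler_sum => a _; rewrite rnormZ -mulrA ler_wpM2l ?rnorm_ge0 //.
  exact: rnorm_op_monomial.
by rewrite -mulr_suml ler_wpM2r // rnorm_ge0.
Qed.

Lemma op_monomial_linear a : linear (op_monomial T a).
Proof.
have it i n : linear (iter n (T i)).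
  by move=> k x y; elim: n => //= n ->; rewrite linearP.
by move=> k x y; rewrite -(mk2K a) !op_monomial_mk2 !it.
Qed.

Lemma box_op_linear N : linear (box_op N).
Proof.
move=> k x y; rewrite /box_op scaler_sumr -big_split /=; apply: eq_bigr => a _.
by rewrite op_monomial_linear scalerDr !scalerA mulrC.
Qed.

Lemma box_op_split (A : {fset multi_index 2}) M h : (A `<=` box M)%fset ->
  box_op M h - \sum_(a <- A) c a *: op_monomial T a h =
  \sum_(a <- (box M `\` A)%fset) c a *: op_monomial T a h.
Proof. exact: sum_fsubset. Qed.

Lemma box_op_cvg h : cvg (box_op n h @[n --> \oo]).
Proof.
apply: cauchy_cvg; apply: cauchy_exP => e e0.
have eE : e = (complex.Re e)%:C%C by rewrite RRe_real // gtr0_real.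
move: e0; rewrite eE ltcR; move: (complex.Re e) => r r0.
have p0 : 0 < 1 + rnorm h by rewrite ltr_pwDl // rnorm_ge0.
have [N NP] := @box_op_tail (r / (1 + rnorm h)) (divr_gt0 r0 p0).
exists (box_op N h); exists N => // M NM /=; rewrite -ball_normE /= rnormE ltcR rnormB.
rewrite box_op_split ?box_mono //.
apply: le_lt_trans (NP _ _ h) _; first by move=> a; rewrite inE => /andP[].
by rewrite mulrAC ltr_pdivrMr // ltr_pM2l // ltrDr.
Qed.

Definition sum_op h := lim (box_op n h @[n --> \oo]).

Lemma sum_op_near h (e : R) : 0 < e ->
  exists N, forall M, (N <= M)%N -> rnorm (sum_op h - box_op M h) <= e.
Proof.
move=> e0; have /cvgrPdist_le/(_ e%:C%C) := @box_op_cvg h.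
rewrite ltcR => /(_ e0)[N _ NP].
by exists N => M /NP /=; rewrite rnormE lecR.
Qed.

Lemma sum_op_linear : linear sum_op.
Proof.
move=> k x y; apply: (@cvg_lim _ (@norm_hausdorff _ H)).
rewrite (_ : (fun n => _) = (fun n => k *: box_op n x + box_op n y)); last first.
  by apply/funext => n; rewrite box_op_linear.
by apply: cvgD; [apply: cvgZr|]; exact: box_op_cvg.
Qed.

HB.instance Definition _ := GRing.isLinear.Build R[i] H H _ sum_op sum_op_linear.

Lemma sum_op_tail (e : R) : 0 < e -> exists N, forall A : {fset multi_index 2},
  (box N `<=` A)%fset ->
  forall h, rnorm (sum_op h - \sum_(a <- A) c a *: op_monomial T a h) <= e * rnorm h.
Proof.
move=> e0; have [N NP] := box_op_tail e0; exists N => A NA h.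
apply/ler_addgt0Pr => e' e'0; have [M0 M0P] := sum_op_near h e'0.
have [M1 M1P] := sub_box A; set M := maxn M0 M1.
have -> : sum_op h - \sum_(a <- A) c a *: op_monomial T a h =
    (sum_op h - box_op M h) + (box_op M h - \sum_(a <- A) c a *: op_monomial T a h).
  by rewrite addrA subrK.
rewrite (le_trans (rnormD _ _)) // addrC lerD ?M0P ?leq_maxl //.
rewrite box_op_split ?M1P ?leq_maxr // NP // => a; rewrite inE => /andP[+ _].
by apply: contra; apply: fsubsetP.
Qed.

Lemma sum_op_le1 h : rnorm (sum_op h) <= rnorm h.
Proof.
have h0 := rnorm_ge0 h.
apply/ler_addgt0Pr => e e0.
pose d := e / (2 * (1 + rnorm h)).
have d0 : 0 < d by rewrite divr_gt0 // mulr_gt0 // ltr_pwDl.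
have [N NP] := sum_op_tail d0; have [N0 N0P] := box_op_bound d0.
set M := maxn N N0.
have h1 := NP _ (box_mono (leq_maxl N N0)) h; have h2 := N0P _ (leq_maxr N N0) h.
have -> : sum_op h = (sum_op h - box_op M h) + box_op M h by rewrite subrK.
rewrite (le_trans (rnormD _ _)) // (le_trans (lerD h1 h2)) //.
have : d * (2 * rnorm h) <= e.
  rewrite /d mulrAC ler_pdivrMr ?mulr_gt0 ?ltr_pwDl // ler_pM2l //; lra.
lra.
Qed.

Lemma agler_sum : exists2 F : {linear H -> H}, op_expansion c T F & (opnorm F <= 1)%E.
Proof.
exists sum_op; last by apply: opnorm_le => // h; rewrite mul1r sum_op_le1.
pose rem A h := sum_op h - partial_sum (fun a => c a *: op_monomial T a h) A.
have near_le (e : R) : 0 < e -> \forall A \near totally, (opnorm (rem A) <= e%:E)%E.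
  move=> e0; have [N NP] := sum_op_tail e0; exists (box N) => // A NA /=.
  by apply: opnorm_le => [|h]; [exact: ltW | rewrite /rem partial_sumE NP].
apply/fine_cvgP; split.
  near=> A; rewrite ge0_fin_numE ?opnorm_ge0 //.
  apply: (@le_lt_trans _ _ 1%:E); last exact: ltry.
  by near: A; apply: near_le.
apply/cvgrPdist_le => e e0; near=> A; rewrite sub0r normrN /=.
have le : (opnorm (rem A) <= e%:E)%E.
  by near: A; apply: near_le.
rewrite ger0_norm ?fine_ge0 ?opnorm_ge0 // -lee_fin fineK //.
by rewrite ge0_fin_numE ?opnorm_ge0 // (le_lt_trans le) // ltry.
Unshelve. all: by end_near. Qed.

End AglerSum.

Lemma opnorm_lt1 (R : realType) (H : normedModType R[i]) (G : {linear H -> H}) :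
  (opnorm G < 1)%E -> exists2 t : R, 0 < t < 1 & forall h, rnorm (G h) <= t * rnorm h.
Proof.
move=> G1; pose s := fine (opnorm G); have G0 := opnorm_ge0 G.
have Gfin : opnorm G \is a fin_num by rewrite ge0_fin_numE // (lt_trans G1) // ltry.
have sE : opnorm G = s%:E by rewrite fineK.
have s0 : 0 <= s by rewrite fine_ge0.
have s1 : s < 1 by rewrite -lte_fin -sE.
exists ((s + 1) / 2); first by apply/andP; split; lra.
move=> h; have [->|h0] := eqVneq h 0; first by rewrite linear0 !rnorm0 mulr0.
have hp : 0 < rnorm h by rewrite lt_neqAle eq_sym rnorm_eq0 h0 rnorm_ge0.
have : rnorm (G ((rnorm h)^-1%:C%C *: h)) <= s.
  rewrite -lee_fin -sE; apply: ereal_sup_ubound; exists ((rnorm h)^-1%:C%C *: h) => //=.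
  rewrite rnormE -[1]/(1%:C%C) lecR rnormZ rnormR ger0_norm ?invr_ge0 ?rnorm_ge0 //.
  by rewrite mulVf ?gt_eqF.
rewrite linearZ /= rnormZ rnormR ger0_norm ?invr_ge0 ?rnorm_ge0 //.
rewrite mulrC ler_pdivrMr // => h1.
by apply: le_trans h1 _; rewrite ler_pM2r //; lra.
Qed.

(** The norms of both operators are at most some t < 1, a radius at which the
    series of coefficients converges absolutely. *)
Theorem schur_agler2 (R : realType) (f : 'rV[R[i]]_2 -> R[i]) c :
  expansion f c -> schur_class f -> agler_class f.
Proof.
move=> fc fS; split=> //; exists c => // H dot hn T Tc T1.
have [t0 t01 Tt0] := opnorm_lt1 (T1 0); have [t1 t11 Tt1] := opnorm_lt1 (T1 1).
apply: (@agler_sum _ f c fc _ H dot hn T Tc (Num.max t0 t1)).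
- by move=> z /fS[].
- by case: (leP t0 t1).
- move=> i h; have [->|->] : i = 0 \/ i = 1.
    by case: (unliftP 0 i) => [l ->|->]; [right; apply: val_inj; rewrite /= ord1 | left].
  + by rewrite (le_trans (Tt0 h)) // ler_wpM2r ?rnorm_ge0 // le_max lexx.
  + by rewrite (le_trans (Tt1 h)) // ler_wpM2r ?rnorm_ge0 // le_max lexx orbT.
Qed.

(** * Coefficients of a given degree *)

Section Homogeneous.
Local Open Scope sesquilinear_scope.
Variables (C : numClosedFieldType) (N n : nat) (p : nat -> nat -> C) (beta : C).
Hypothesis n0 : (0 < n)%N.
Hypothesis nN : (n < N)%N.
Hypothesis pb : forall a b : C, `|a| = 1 -> `|b| = 1 ->
  `|poly2 (\matrix_(i < N, j < N) p i j) a b| <= beta.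

(* Long enough for the degrees to be read off without wrap-around. *)
Let L := (n + (N + N)).+1.
Let P := \matrix_(i < N, j < N) p i j.

(** The rows are indexed modulo n and the columns by the degree; f1 and f2 both
    raise the degree by one, and f1 also moves to the next row. *)
Let f1 : {linear 'M[C]_(n, L) -> 'M[C]_(n, L)} :=
  mulmxr (cshift C L) \o mulmx (cshift C n)^T.
Let f2 : {linear 'M[C]_(n, L) -> 'M[C]_(n, L)} := mulmxr (cshift C L).

Lemma delta_cshift m l (k : 'I_m) (j : 'I_l) :
  (delta_mx k j : 'M[C]_(m, l)) *m cshift C l = delta_mx k (ordS j).
Proof.
apply/row_matrixP => i; rewrite row_mul; apply/rowP => h.
rewrite !mxE (bigD1 j) //= !mxE eqxx andbT permE big1 ?addr0 => [|h' h'j].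
  by case: (i == k); rewrite ?mul0r ?mul1r // eq_sym.
by rewrite !mxE (negbTE h'j) andbF mul0r.
Qed.

Let orbit_delta i j (k : 'I_n) (l : 'I_L) : iter i f1 (iter j f2 (delta_mx k l)) =
  delta_mx (iter i (@ordS n) k) (iter (i + j) (@ordS L) l).
Proof.
have -> : iter j f2 (delta_mx k l) = delta_mx k (iter j (@ordS L) l).
  by elim: j => //= j ->; rewrite delta_cshift.
elim: i => //= i ->; rewrite -[delta_mx _ _ in LHS]trmxK trmx_delta -trmx_mul.
by rewrite delta_cshift trmx_delta delta_cshift.
Qed.

Let iter_ordS m i (k : 'I_m) : iter i (@ordS m) k = ((k + i) %% m)%N :> nat.
Proof.
elim: i => [|i IH] /=; first by rewrite addn0 modn_small.
by rewrite IH -addn1 modnDml addn1 addnS.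
Qed.

Let opoly_delta (k : 'I_n) (l : 'I_L) (k' : 'I_n) (l' : 'I_L) : (l <= n)%N ->
  opoly P f1 f2 (delta_mx k l) k' l' =
  \sum_(i < N) \sum_(j < N) p i j *
    ((k' == ((k + i) %% n)%N :> nat) && (l' == (l + (i + j))%N :> nat))%:R.
Proof.
move=> ln; rewrite summxE; apply: eq_bigr => i _; rewrite summxE; apply: eq_bigr => j _.
have lij : (l + (i + j) < L)%N by rewrite ltnS leq_add // leq_add // ltnW.
by rewrite orbit_delta !mxE -!val_eqE /= !iter_ordS (modn_small lij).
Qed.

Let z0 : 'I_n := Ordinal n0.
Let c0 : 'I_L := ord0.
Let cn : 'I_L := inord n.

Let cnE : cn = n :> nat.
Proof. by rewrite inordK // ltnS leq_addr. Qed.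

(** The coefficients of the part of degree n of p, reduced modulo z^n = w^n. *)
Definition folded (k : nat) : C := p k (n - k)%N + (k == 0)%:R * p n 0%N.

Let diag_sum (F : nat -> C) :
  \sum_(i < N) \sum_(j < N) p i j * (F i * (n == (i + j)%N :> nat)%:R) =
  \sum_(i < n.+1) p i (n - i)%N * F i.
Proof.
pose G i := \sum_(j < N) p i j * (F i * (n == (i + j)%N :> nat)%:R).
rewrite -[LHS](big_mkord xpredT G).
rewrite (big_cat_nat (n := n.+1)) //= [X in _ + X](_ : _ = 0) ?addr0; last first.
  rewrite big_nat big1 // => i /andP[ni _]; rewrite /G big1 // => j _.
  by rewrite (_ : (n == (i + j)%N) = false) ?mulr0 //; rewrite ltn_eqF // ltn_addr.
rewrite big_mkord; apply: eq_bigr => i _.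
have ni : (n - i < N)%N by apply: leq_ltn_trans nN; apply: leq_subr.
rewrite /G (bigD1 (Ordinal ni)) //= subnKC ?(ltnSE (ltn_ord i)) // eqxx mulr1.
rewrite big1 ?addr0 // => j jn.
rewrite (_ : (n == (i + j)%N) = false) ?mulr0 //; apply: contraNF jn => /eqP nij.
by apply/eqP/val_inj; rewrite /= [X in (X - _)%N]nij addKn.
Qed.

Let y_first : opoly P f1 f2 (delta_mx z0 c0) z0 c0 = p 0 0.
Proof.
have N0 : (0 < N)%N by apply: leq_ltn_trans nN.
rewrite opoly_delta // (bigD1 (Ordinal N0)) //= (bigD1 (Ordinal N0)) //=.
rewrite !add0n mod0n eqxx mulr1.
rewrite big1 ?addr0 => [|j j0].
  rewrite big1 ?addr0 // => i i0; rewrite big1 // => j _.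
  rewrite -val_eqE /= in i0.
  by rewrite !add0n [X in _ && X]eq_sym addn_eq0 (negbTE i0) andbF mulr0.
by rewrite -val_eqE /= in j0; rewrite !add0n [X in _ && X]eq_sym (negbTE j0) andbF mulr0.
Qed.

Let y_first_cn (k : 'I_n) : opoly P f1 f2 (delta_mx k cn) z0 c0 = 0.
Proof.
rewrite opoly_delta ?cnE // big1 // => i _; rewrite big1 // => j _.
by rewrite [X in _ && X]eq_sym addn_eq0 (gtn_eqF n0) andbF mulr0.
Qed.

Let y_cn (k : 'I_n) : opoly P f1 f2 (delta_mx z0 c0) k cn = folded k.
Proof.
rewrite opoly_delta //; under eq_bigr do under eq_bigr do rewrite cnE !add0n -mulnb natrM.
rewrite (diag_sum (fun i => (k == (i %% n)%N :> nat)%:R)) big_ord_recr /= modnn subnn.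
rewrite (bigD1 k) //= modn_small // eqxx mulr1 big1 ?addr0 => [|i ik].
  by rewrite /folded mulrC.
by rewrite modn_small // eq_sym val_eqE (negbTE ik) mulr0.
Qed.

Let y_cn_cn (k k' : 'I_n) : opoly P f1 f2 (delta_mx k' cn) k cn = (k == k')%:R * p 0 0.
Proof.
have N0 : (0 < N)%N by apply: leq_ltn_trans nN.
rewrite opoly_delta ?cnE // (bigD1 (Ordinal N0)) //= (bigD1 (Ordinal N0)) //=.
rewrite !addn0 modn_small // eqxx andbT mulrC.
have cnD m : (n == (n + m)%N) = (m == 0)%N.
  by rewrite -{1}[n]addn0 eqn_add2l eq_sym.
rewrite big1 ?addr0 => [|j j0].
  rewrite big1 ?addr0 // => i i0; rewrite big1 // => j _.
  by rewrite -val_eqE /= in i0; rewrite cnD addn_eq0 (negbTE i0) andbF mulr0.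
by rewrite -val_eqE /= in j0; rewrite cnD add0n (negbTE j0) andbF mulr0.
Qed.

(** Von Neumann's inequality for f1, f2 and a vector X with alpha in degree 0 and a
    multiple of the folded coefficients in degree n. The image of X has alpha p_00
    in degree 0, and in degree n the row k receives alpha folded_k from the first
    part of X and p_00 times the entry of X from the second; the factor
    (p 0 0)^* in X makes these two contributions add up in modulus. *)
Lemma folded_energy (alpha s : C) : 0 <= alpha -> 0 <= s ->
  alpha ^+ 2 * `|p 0 0| ^+ 2 +
    (\sum_(k < n) `|folded k| ^+ 2) * (alpha + s * `|p 0 0| ^+ 2) ^+ 2 <=
  beta ^+ 2 * (alpha ^+ 2 + s ^+ 2 * `|p 0 0| ^+ 2 * \sum_(k < n) `|folded k| ^+ 2).
Proof.
move=> a0 s0; set A := `|p 0 0| ^+ 2; set S := \sum_(k < n) _.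
pose q (k : 'I_n) := s * (p 0 0)^* * folded k.
pose X : 'M[C]_(n, L) := alpha *: delta_mx z0 c0 + \sum_k q k *: delta_mx k cn.
have iso_r (Y Z : 'M[C]_(n, L)) : \tr (f2 Y *m (f2 Z)^t*) = \tr (Y *m Z^t*).
  by rewrite /f2 /= trmxC_mul mulmxA mulmxtVK ?cshift_unitary.
have iso_f1 (Y Z : 'M[C]_(n, L)) : \tr (f1 Y *m (f1 Z)^t*) = \tr (Y *m Z^t*).
  have uT : ((cshift C n)^T)^t* *m (cshift C n)^T = 1%:M.
    by apply: mulmx1C; apply/unitarymxP; rewrite trmx_unitary cshift_unitary.
  rewrite -[f1 Y]/(f2 _) -[f1 Z]/(f2 _) iso_r trmxC_mul mulmxA mxtrace_mulC !mulmxA uT.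
  by rewrite mul1mx.
have f12 Y : f1 (f2 Y) = f2 (f1 Y) by rewrite /f1 /f2 /= !mulmxA.
have := commuting_isometry_von_neumann X iso_f1 iso_r f12 pb.
have c0n : c0 != cn by rewrite -val_eqE /= cnE; case: (n) n0.
have Xc0 k : X k c0 = alpha * (k == z0)%:R.
  rewrite !mxE eqxx andbT summxE big1 ?addr0 // => k' _.
  by rewrite !mxE (negbTE c0n) andbF mulr0.
have Xcn k : X k cn = q k.
  rewrite !mxE [cn == _]eq_sym (negbTE c0n) andbF mulr0 add0r summxE (bigD1 k) //=.
  rewrite !mxE !eqxx mulr1.
  by rewrite big1 ?addr0 // => k' kk; rewrite !mxE eq_sym (negbTE kk) mulr0.
have Xoff k l : l != c0 -> l != cn -> X k l = 0.
  move=> lc0 lcn; rewrite !mxE (negbTE lc0) andbF mulr0 add0r summxE big1 // => k' _.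
  by rewrite !mxE (negbTE lcn) andbF mulr0.
have two_cols (F : 'I_L -> C) : (forall l, l != c0 -> l != cn -> F l = 0) ->
    \sum_l F l = F c0 + F cn.
  move=> F0; rewrite (bigD1 c0) //= (bigD1 cn) 1?eq_sym //=.
  rewrite [X in _ + (_ + X)]big1 ?addr0 //.
  by move=> l /andP[lc0 lcn]; exact: F0.
have -> : frob X = alpha ^+ 2 + s ^+ 2 * A * S.
  rewrite frobE (eq_bigr (fun k => `|X k c0| ^+ 2 + `|X k cn| ^+ 2)) => [|k _]; last first.
    by rewrite two_cols // => l l0 ln; rewrite Xoff // normr0 expr0n.
  rewrite big_split /=; congr (_ + _).
    rewrite (bigD1 z0) //= Xc0 eqxx mulr1 ger0_norm // big1 ?addr0 // => k kz.
    by rewrite Xc0 (negbTE kz) mulr0 normr0 expr0n.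
  rewrite mulr_sumr; apply: eq_bigr => k _; rewrite Xcn /q !normrM !exprMn norm_conjC.
  by rewrite (ger0_norm s0).
apply: le_trans.
have yE k l : opoly P f1 f2 X k l = alpha * opoly P f1 f2 (delta_mx z0 c0) k l +
    \sum_k' q k' * opoly P f1 f2 (delta_mx k' cn) k l.
  rewrite /X linearD linearZ linear_sum /= mxE; congr (_ + _); first by rewrite mxE.
  rewrite (summxE _ _ (fun k' => opoly _ _ _ (q k' *: delta_mx k' cn))).
  by apply: eq_bigr => k' _; rewrite linearZ /= mxE.
apply: (@le_trans _ _
  (`|opoly P f1 f2 X z0 c0| ^+ 2 + \sum_k `|opoly P f1 f2 X k cn| ^+ 2)).
  rewrite yE y_first big1 ?addr0 => [|k _]; last by rewrite y_first_cn mulr0.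
  rewrite normrM exprMn ger0_norm // lerD2l mulr_suml; apply: ler_sum => k _.
  rewrite yE y_cn (bigD1 k) //= y_cn_cn eqxx mul1r big1 ?addr0 => [|k' kk]; last first.
    by rewrite y_cn_cn eq_sym (negbTE kk) mul0r mulr0.
  have -> : alpha * folded k + q k * p 0 0 = folded k * (alpha + s * A).
    by rewrite /A normCK /q; ring.
  rewrite normrM exprMn [X in _ * X ^+ 2]ger0_norm //.
  by rewrite addr_ge0 // mulr_ge0 // exprn_ge0.
move: (opoly P f1 f2 X) => y; rewrite frobE.
have sq0 k l : 0 <= `|y k l| ^+ 2 by exact: exprn_ge0.
have rowE k : \sum_l `|y k l| ^+ 2 >= `|y k c0| ^+ 2 + `|y k cn| ^+ 2.
  by rewrite (bigD1 c0) //= (bigD1 cn) 1?eq_sym //= addrA lerDl sumr_ge0.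
apply: (le_trans _ (ler_sum _ (fun k _ => rowE k))).
by rewrite big_split lerD2r (bigD1 z0) //= lerDl sumr_ge0.
Qed.

End Homogeneous.

(** * The lower bound for the Bohr radius *)

Lemma ler_sqr_slack (R : realFieldType) (x y : R) : 0 <= y ->
  (forall e, 0 < e -> x <= (1 + e) ^+ 2 * y) -> x <= y.
Proof.
move=> y0 xy; apply/ler_addgt0Pr => e e0.
have y1 : 0 < 3 * (y + 1) by lra.
pose d := Num.min 1 (e / (3 * (y + 1))).
have d0 : 0 < d by rewrite lt_min ltr01 divr_gt0.
have d1 : d <= 1 by rewrite ge_min lexx.
have : d * (3 * (y + 1)) <= e by rewrite -ler_pdivlMr // ge_min lexx orbT.
have := xy _ d0.
have : 0 <= d * (1 - d) * y by rewrite !mulr_ge0 ?subr_ge0 ?(ltW d0).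
lra.
Qed.

(** Rotating the variable makes the coefficients of z^n and w^n point in the same
    direction. *)
Lemma align_phase (R : realType) (u v : R[i]) n : (0 < n)%N ->
  exists2 w : R[i], `|w| = 1 & rnorm (u + v * w ^+ n) = rnorm u + rnorm v.
Proof.
move=> n0; have [->|u0] := eqVneq u 0.
  by exists 1; rewrite ?normr1 // expr1n mulr1 rnorm0 !add0r.
have [->|v0] := eqVneq v 0.
  by exists 1; rewrite ?normr1 // expr1n mulr1 rnorm0 !addr0.
pose w := u / `|u| * (`|v| / v); exists (n.-root w).
  apply/eqP; rewrite -(pexpr_eq1 n0) // -normrX rootCK //.
  by rewrite /w !normrM !normfV !normr_id divff ?normr_eq0 // mul1r divff // normr_eq0.
rewrite rootCK //; apply: complexI; rewrite rmorphD /= -!rnormE.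
have nu : `|u| != 0 by rewrite normr_eq0.
have -> : u + v * w = u / `|u| * (`|u| + `|v|) by rewrite /w; field; rewrite v0 nu.
by rewrite !normrM normfV normr_id divff // mul1r ger0_norm // addr_ge0.
Qed.

Lemma sqr_sum_le (R : realFieldType) n (x : nat -> R) :
  (\sum_(k < n) x k) ^+ 2 <= n%:R * \sum_(k < n) x k ^+ 2.
Proof.
elim: n => [|n IH]; first by rewrite !big_ord0 expr0n mul0r.
rewrite !big_ord_recr /= -[n.+1]addn1 natrD.
set s := \sum_(k < n) x k in IH *; set q := \sum_(k < n) x k ^+ 2 in IH *.
have : 0 <= \sum_(k < n) (x k - x n) ^+ 2 by apply: sumr_ge0 => k _; apply: sqr_ge0.
have -> : \sum_(k < n) (x k - x n) ^+ 2 = q - x n * s *+ 2 + x n ^+ 2 * n%:R.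
  under eq_bigr do rewrite sqrrB.
  rewrite big_split sumrB /= sumr_const card_ord mulr_natr; congr (_ - _ + _).
  by rewrite sumrMnl mulr_sumr; congr (_ *+ _); apply: eq_bigr => k _; rewrite mulrC.
lra.
Qed.

Section DegreeBound.
Variables (R : realType) (f : 'rV[R[i]]_2 -> R[i]) (c : multi_index 2 -> R[i]).
Hypothesis fc : expansion f c.
Hypothesis f1 : forall z, polydisk z -> `|f z| <= 1.
Variable t : R.
Hypothesis t01 : 0 <= t < 1.

Definition folded_norm n k : R :=
  if k == 0 then rnorm (c (mk2 0 n)) + rnorm (c (mk2 n 0)) else rnorm (c (mk2 k (n - k))).

(** [folded_energy] for the truncations of f(t z, t w), rotated by [align_phase],
    whose bounds on the torus tend to 1. *)
Lemma folded_norm_energy n (alpha s : R) : (0 < n)%N -> 0 <= alpha -> 0 <= s ->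
  alpha ^+ 2 * rnorm (c (mk2 0 0)) ^+ 2 +
    (\sum_(k < n) (folded_norm n k * t ^+ n) ^+ 2) *
    (alpha + s * rnorm (c (mk2 0 0)) ^+ 2) ^+ 2 <=
  alpha ^+ 2 + s ^+ 2 * rnorm (c (mk2 0 0)) ^+ 2 *
    \sum_(k < n) (folded_norm n k * t ^+ n) ^+ 2.
Proof.
move=> n0 a0 s0; set A := rnorm _ ^+ 2; set S := \sum_(k < n) _.
have [t0 t1] := andP t01.
have S0 : 0 <= S by apply: sumr_ge0 => k _; apply: sqr_ge0.
apply: ler_sqr_slack => [|e e0].
  by rewrite addr_ge0 ?mulr_ge0 ?exprn_ge0 ?rnorm_ge0.
have [N0 N0P] := box_poly_bound fc t01 e0 f1.
have [w w1 wn] := align_phase (c (mk2 0 n)) (c (mk2 n 0)) n0.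
have rw : rnorm w = 1 by apply: complexI; rewrite -rnormE w1.
pose N := maxn N0 n.+1.
pose p i j := c (mk2 i j) * (t ^+ (i + j))%:C%C * w ^+ i.
have pb (a b : R[i]) : `|a| = 1 -> `|b| = 1 ->
    `|poly2 (\matrix_(i < N, j < N) p i j) a b| <= (1 + e)%:C%C.
  move=> a1 b1; have wa : `|w * a| = 1 by rewrite normrM w1 a1 mulr1.
  rewrite (_ : poly2 _ a b = poly2 (box_poly c t N) (w * a) b).
    by apply: N0P => //; apply: leq_maxl.
  apply: eq_bigr => i _; apply: eq_bigr => j _.
  by rewrite !mxE /p exprMn; ring.
have aC : 0 <= alpha%:C%C by rewrite ler0c.
have sC : 0 <= s%:C%C by rewrite ler0c.
have := folded_energy n0 (leq_maxr N0 n.+1) pb aC sC.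
have -> : `|p 0 0| ^+ 2 = A%:C%C.
  by rewrite /p mulr1 mulr1 rnormE rmorphXn.
have -> : \sum_(k < n) `|folded n p k| ^+ 2 = S%:C%C.
  rewrite rmorph_sum; apply: eq_bigr => k _ /=.
  rewrite rnormE [in RHS]rmorphXn; congr ((_%:C%C) ^+ 2).
  rewrite /folded /folded_norm /p; case: eqP => [->|k0].
    rewrite subn0 add0n addn0 mul1r mulr1 -wn.
    rewrite -[X in _ = _ * X](ger0_norm (exprn_ge0 n t0)).
    rewrite -[X in _ = _ * X]rnormR -rnormM.
    by congr (rnorm _); ring.
  rewrite mul0r addr0 rnormM rnormX rw expr1n mulr1 rnormM rnormR subnKC ?(ltnW (ltn_ord k)) //.
  by rewrite ger0_norm // exprn_ge0.
by rewrite -lecR !(rmorphD, rmorphM, rmorphXn).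
Qed.

(** With A = |f_00|^2 and S the sum of squares, the choices (alpha, s) = (1, 0) and
    (1 - A, 1) in [folded_norm_energy] give A + S <= 1 and
    S (1 - A) <= (1 - A)^3; Cauchy-Schwarz then bounds the sum of n terms. *)
Lemma folded_norm_sum n : (0 < n)%N ->
  rnorm (c (mk2 0 0)) <= 1 /\
  (\sum_(k < n) folded_norm n k) * t ^+ n <=
  Num.sqrt n%:R * (1 - rnorm (c (mk2 0 0)) ^+ 2).
Proof.
move=> n0; have h1 := folded_norm_energy n0 ler01 (lexx 0).
set a := rnorm _ in h1 *; set S := \sum_(k < n) _ in h1.
have S0 : 0 <= S by apply: sumr_ge0 => k _; apply: sqr_ge0.
have a0 : 0 <= a by apply: rnorm_ge0.
have A1 : a ^+ 2 + S <= 1.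
  by move: h1; rewrite !mul0r expr1n mul1r !addr0 !expr0n !mul0r expr1n mulr1 addr0.
have a1 : a <= 1 by rewrite -(@ler_pXn2r _ 2) ?nnegrE // expr1n; lra.
split=> //.
have SA : S <= (1 - a ^+ 2) ^+ 2.
  have B0 : 0 <= 1 - a ^+ 2 by lra.
  have := @folded_norm_energy n (1 - a ^+ 2) 1 n0 B0 ler01; rewrite -/a -/S.
  have [B1|B1] := eqVneq (a ^+ 2) 1; first by rewrite B1 => _; lra.
  have Bp : 0 < 1 - a ^+ 2 by rewrite lt_neqAle eq_sym subr_eq0 eq_sym B1.
  move=> h; have : S * (1 - a ^+ 2) <= (1 - a ^+ 2) ^+ 2 * (1 - a ^+ 2) by lra.
  by rewrite ler_pM2r.
rewrite mulr_suml -[leLHS]ger0_norm; last first.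
  rewrite sumr_ge0 // => k _; rewrite mulr_ge0 ?exprn_ge0 //; last by case/andP: t01.
  by rewrite /folded_norm; case: ifP => _; rewrite ?addr_ge0 ?rnorm_ge0.
rewrite -sqrtr_sqr -[1 - _]ger0_norm; last by lra.
rewrite -sqrtr_sqr -sqrtrM // ler_wsqrtr //.
apply: le_trans (sqr_sum_le n (fun k => folded_norm n k * t ^+ n)) _.
by rewrite ler_wpM2l.
Qed.

Lemma diag_sum_folded n : (0 < n)%N ->
  \sum_(k < n.+1) rnorm (c (mk2 k (n - k))) = \sum_(k < n) folded_norm n k.
Proof.
case: n => // n _; rewrite big_ord_recr /= subnn big_ord_recl [RHS]big_ord_recl /=.
by rewrite addrAC.
Qed.

End DegreeBound.

(** The first terms are added up with rational upper bounds of the square roots.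
    From n = 9 on, sqrt n <= (n + 9) / 6, the tangent at 9, and the remaining
    terms are absorbed by g, since g n - g (n + 1) >= sqrt n x^n. *)
Lemma sqrt_series_bound (R : realType) (D : nat) :
  \sum_(n < D) Num.sqrt n%:R * (3006%:R / 10%:R ^+ 4) ^+ n <= 1 / 2 :> R.
Proof.
set x : R := 3006%:R / 10%:R ^+ 4.
have xE : x = 3006 / 10000 by rewrite /x; field.
have x0 : 0 <= x by rewrite xE; lra.
have term0 n : 0 <= Num.sqrt n%:R * x ^+ n by rewrite mulr_ge0 ?sqrtr_ge0 ?exprn_ge0.
have sq (a b : R) : 0 <= b -> a <= b ^+ 2 -> Num.sqrt a <= b.
  by move=> b0 ab; rewrite -[leRHS](ger0_norm b0) -sqrtr_sqr ler_wsqrtr.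
pose g n : R := (6 / 25 * n%:R + 9 / 4) * x ^+ n.
have big k : \sum_(n < 9 + k) Num.sqrt n%:R * x ^+ n + g (9 + k)%N <= 1 / 2.
  elim: k => [|k IH].
    rewrite addn0 !big_ord_recl big_ord0 /= /bump /= !add1n /g.
    rewrite sqrtr0 sqrtr1 mul0r add0r addr0 !mul1r.
    have b k0 (b0 : R) : 0 <= b0 -> k0%:R <= b0 ^+ 2 ->
        Num.sqrt k0%:R * x ^+ k0 <= b0 * x ^+ k0.
      by move=> h1 h2; rewrite ler_wpM2r ?exprn_ge0 // sq.
    have b2 := b 2 (99 / 70) ltac:(lra) ltac:(lra).
    have b3 := b 3 (97 / 56) ltac:(lra) ltac:(lra).
    have b4 := b 4 2 ltac:(lra) ltac:(lra).
    have b5 := b 5 (161 / 72) ltac:(lra) ltac:(lra).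
    have b6 := b 6 (49 / 20) ltac:(lra) ltac:(lra).
    have b7 := b 7 (127 / 48) ltac:(lra) ltac:(lra).
    have b8 := b 8 (99 / 35) ltac:(lra) ltac:(lra).
    move: b2 b3 b4 b5 b6 b7 b8.
    move: (Num.sqrt 2%:R) (Num.sqrt 3%:R) (Num.sqrt 4%:R) (Num.sqrt 5%:R).
    move: (Num.sqrt 6%:R) (Num.sqrt 7%:R) (Num.sqrt 8%:R).
    rewrite xE => s6 s7 s8 s2 s3 s4 s5; lra.
  apply: le_trans IH; rewrite addnS big_ord_recr /= -addrA lerD2l.
  move: (9 + k)%N => m; rewrite /g exprSr -[m.+1]addn1 natrD.
  have hs : Num.sqrt m%:R <= (m%:R + 9) / 6 :> R.
    apply: sq; first by rewrite divr_ge0 // addr_ge0.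
    have := sqr_ge0 (m%:R - 9 : R); lra.
  have m0 : 0 <= m%:R :> R by [].
  have -> : Num.sqrt m%:R * x ^+ m + (6 / 25 * (m%:R + 1) + 9 / 4) * (x ^+ m * x) =
      (Num.sqrt m%:R + (6 / 25 * (m%:R + 1) + 9 / 4) * x) * x ^+ m by ring.
  rewrite ler_wpM2r ?exprn_ge0 //.
  by rewrite xE; lra.
have [D9|D9] := leqP D 9.
  have := big 0%N; rewrite addn0 => h9.
  have g0 : 0 <= g 9%N by rewrite mulr_ge0 ?exprn_ge0 //; lra.
  apply: le_trans (_ : \sum_(n < 9) Num.sqrt n%:R * x ^+ n <= _); last by lra.
  rewrite -!(big_mkord xpredT (fun n => Num.sqrt n%:R * x ^+ n)).
  by rewrite [leRHS](big_cat_nat (n := D)) //= lerDl sumr_ge0.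
have := big (D - 9)%N; rewrite subnKC ?(ltnW D9) // => hD.
have g0 : 0 <= g D by rewrite mulr_ge0 ?exprn_ge0 // addr_ge0 // ?mulr_ge0 //; lra.
lra.
Qed.

(** The sum over all coefficients is at most a + (1 - a^2) / 2, where a = |f_00|.
    Only radii r < x are treated, so that r = t x with t < 1 and the factors t^n
    move the coefficient bounds inside the disk. *)
Lemma schur_norm1 (R : realType) (f : 'rV[R[i]]_2 -> R[i]) c (r : R) :
  expansion f c -> (forall z, polydisk z -> `|f z| <= 1) ->
  0 < r < 3006%:R / 10%:R ^+ 4 -> (norm1 (dilate r c) <= 1)%E.
Proof.
move=> fc f1; set x : R := 3006%:R / 10%:R ^+ 4 => /andP[r0 rx].
have x0 : 0 < x by apply: lt_trans rx.
pose t := r / x; have t01 : 0 <= t < 1.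
  by rewrite /t divr_ge0 ?(ltW r0) ?(ltW x0) //= ltr_pdivrMr // mul1r.
have [t0 _] := andP t01.
have rE : r = t * x by rewrite /t divfK // gt_eqF.
pose F (m : multi_index 2) := rnorm (dilate r c m).
have F0 m : 0 <= F m by apply: rnorm_ge0.
have FE m : F m = rnorm (c m) * t ^+ mdegree m * x ^+ mdegree m.
  by rewrite /F /dilate rnormM rnormX rnormR (gtr0_norm r0) rE exprMn mulrA.
set a := rnorm (c (mk2 0 0)).
have [a1 _] := folded_norm_sum fc f1 t01 (ltn0Sn 0); rewrite -/a in a1.
apply: ge_ereal_sup => _ [A [Afin _] <-].
rewrite fsbig_finite // sumEFin lee_fin.
have [D0 /(_ D0.+1 (leqnSn _)) AD] := sub_box (fset_set A).
pose D := (D0.+1 + D0.+1)%N.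
pose g (j : 'I_D * 'I_D) := mk2 j.2 (j.1 - j.2).
apply: (@le_trans _ _ (\sum_(j : 'I_D * 'I_D | (j.2 <= j.1)%N) F (g j))).
  apply: sum_fset_cover => // m mA.
  have := fsubsetP AD _ mA; rewrite in_box => /andP[m0 m1].
  have mD : (m 0%R + m 1%R < D)%N by rewrite -addnS leq_add // ltnW.
  have m0D : (m 0%R < D)%N by apply: leq_ltn_trans mD; apply: leq_addr.
  by exists (Ordinal mD, Ordinal m0D); rewrite /g /= ?leq_addr // addKn mk2K.
rewrite -(pair_big_dep xpredT
  (fun n k : 'I_D => (k <= n)%N) (fun n k => F (g (n, k)))) /=.
have inner (n : 'I_D) : \sum_(k < D | (k <= n)%N) F (g (n, k)) =
    (\sum_(k < n.+1) rnorm (c (mk2 k (n - k)))) * t ^+ n * x ^+ n.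
  transitivity (\sum_(k < n.+1) F (mk2 k (n - k))).
    by rewrite (big_ord_widen D (fun k => F (mk2 k (n - k))) (ltn_ord n)).
  rewrite !mulr_suml; apply: eq_bigr => k _.
  by rewrite FE mdegree_mk2 subnKC // -ltnS.
under eq_bigr do rewrite inner.
have a0 : 0 <= a by apply: rnorm_ge0.
have A0 : 0 <= 1 - a ^+ 2 by rewrite subr_ge0 exprn_ile1.
apply: (@le_trans _ _ (a + (1 - a ^+ 2) * \sum_(n < D) Num.sqrt n%:R * x ^+ n)).
  rewrite /D addSn !big_ord_recl big_ord0 /= !expr0 !mulr1 addr0 sqrtr0 add0r lerD2l.
  rewrite mulr_sumr; apply: ler_sum => n _.
  rewrite mulrA ler_wpM2r ?exprn_ge0 ?(ltW x0) //.
  have [_] := folded_norm_sum fc f1 t01 (ltn0Sn n).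
  by rewrite -diag_sum_folded // -/a [leRHS]mulrC.
have := sqrt_series_bound R D; rewrite -/x => h.
have := ler_wpM2l A0 h; have := sqr_ge0 (1 - a); lra.
Qed.

Lemma le_sup_interval (R : realType) (S : set R) (x : R) :
  0 < x -> has_ubound S -> (forall r, 0 < r < x -> S r) -> x <= sup S.
Proof.
move=> x0 ubS Sx; rewrite leNgt; apply/negP.
move: (ub_le_sup ubS); move: (sup S) => b ubb bx.
pose m := Num.max 0 b; have m0 : 0 <= m by rewrite le_max lexx.
have bm : b <= m by rewrite le_max lexx orbT.
have mx : m < x by rewrite gt_max x0.
move: m m0 bm mx => m m0 bm mx.
have /ubb : S ((m + x) / 2) by apply: Sx; apply/andP; split; lra.
lra.
Qed.

Lemma radius_bounds (R : realType) : 0 < (3006%:R / 10%:R ^+ 4 : R) < 1.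
Proof.
have -> : 3006%:R / 10%:R ^+ 4 = 3006 / 10000 :> R by field.
by apply/andP; split; lra.
Qed.

Theorem corollary1p2 (R : realType) :
  bohr_agler_radius R 2 = bohr_radius R 2 /\
  3006%:R / 10%:R ^+ 4 <= bohr_radius R 2.
Proof.
split.
  congr sup; apply/seteqP; split=> r /= [r01 rP]; split=> // f fS c fc.
  - exact: rP (schur_agler2 fc fS) _ fc.
  - by apply: rP fc; case: fS.
have /andP[x0 x1] := radius_bounds R.
apply: le_sup_interval; first exact: x0.
  by exists 1 => r /= [/andP[_ /ltW]].
move=> r rx; have /andP[r0 r1] := rx; split; first by rewrite r0 (lt_trans r1).
by move=> f fS c fc; apply: schur_norm1 fc _ rx => z /fS[].
Qed.
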